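(* Let $X_1,\dots,X_r$ be Banach spaces with $M(X_i)>1$ for each $i=1,\dots,r$, and let $\|\cdot\|_\psi$ be an absolute normalized norm on $\mathbb{R}^r$ which is strictly monotone. Then the direct sum $(X_1\oplus\dots\oplus X_r)_\psi$ has the weak fixed point property.
   Context: For a Banach space $X$ and $a\ge0$, $R(a,X)=\sup\{\liminf_{n\to\infty}\|x_n+x\|\}$, the supremum taken over all $x\in X$ with $\|x\|\le a$ and all weakly null sequences $(x_n)$ in the unit ball $B_X$ with $\limsup_{n\to\infty}\limsup_{m\to\infty}\|x_n-x_m\|\le1$; $M(X)=\sup\{(1+a)/R(a,X):a\ge0\}$. A norm on $\mathbb{R}^r$ is absolute if $\|(x_1,\dots,x_r)\|=\|(|x_1|,\dots,|x_r|)\|$, normalized if standard unit vectors have norm 1, strictly monotone if $\|(x_i)\|<\|(y_i)\|$ whenever $|x_i|\le|y_i|$ for all $i$ with strict inequality for some $i$. $(X_1\oplus\dots\oplus X_r)_\psi$ is $X_1\times\dots\times X_r$ with norm $\|(x_1,\dots,x_r)\|_\psi=\|(\|x_1\|,\dots,\|x_r\|)\|_\psi$. A Banach space has the weak fixed point property (WFPP) if every nonexpansive mapping ($\|Tx-Ty\|\le\|x-y\|$) $T:C\to C$ on a nonempty weakly compact convex subset $C$ has a fixed point. *)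

(* Defs.v *)
From HB Require Import structures.
From mathcomp Require Import all_boot all_order all_algebra.
From mathcomp Require Import all_classical all_reals all_analysis.
Set Implicit Arguments. Unset Strict Implicit. Unset Printing Implicit Defensive.
Import Order.TTheory GRing.Theory Num.Theory.
Import numFieldNormedType.Exports.
Local Open Scope classical_set_scope.
Local Open Scope ring_scope.

Section Generic.
(* A real vector space given by explicit operations, with a norm [nrm].
   Used both for a Banach space X (add := +, scale := *:, nrm := normr)
   and for the psi-direct sum (componentwise operations). *)
Variables (R : realType) (V : Type) (add : V -> V -> V) (scale : R -> V -> V)
  (nrm : V -> R).

Definition vsub (x y : V) : V := add x (scale (-1) y).

Definition cont_functional (f : V -> R) : Prop :=
  (forall (a : R) (x y : V), f (add (scale a x) y) = a * f x + f y) /\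
  (exists C : R, forall x, `|f x| <= C * nrm x).

(* x is a cluster point of the set system F for the weak topology
   sigma(V, dual of V): every basic weak neighbourhood of x meets every member of F *)
Definition weak_cluster (F : set_system V) (x : V) : Prop :=
  forall (n : nat) (fs : 'I_n -> V -> R), (forall k, cont_functional (fs k)) ->
  forall eps : R, 0 < eps -> forall A, F A ->
  exists y, A y /\ forall k, `|fs k y - fs k x| < eps.

Definition proper_filter (F : set_system V) : Prop :=
  [/\ F setT, ~ F set0, (forall A B, F A -> F B -> F (A `&` B)) &
      (forall A B, A `<=` B -> F A -> F B)].

Definition weakly_compact (C : set V) : Prop :=
  forall F : set_system V, proper_filter F -> F C ->
  exists x, C x /\ weak_cluster F x.

Definition convex_set (C : set V) : Prop :=
  forall x y (t : R), C x -> C y -> 0 <= t -> t <= 1 ->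
  C (add (scale t x) (scale (1 - t) y)).

Definition nonexpansive_on (C : set V) (T : V -> V) : Prop :=
  forall x y, C x -> C y -> nrm (vsub (T x) (T y)) <= nrm (vsub x y).

Definition WFPP : Prop :=
  forall (C : set V) (T : V -> V),
    C !=set0 -> convex_set C -> weakly_compact C ->
    (forall x, C x -> C (T x)) -> nonexpansive_on C T ->
    exists x, C x /\ T x = x.

Definition weakly_null (u : nat -> V) : Prop :=
  forall f, cont_functional f -> (fun n => f (u n)) @ \oo --> (0 : R).

End Generic.

Section Coeff.
Variables (R : realType) (X : normedModType R).
Local Open Scope ereal_scope.

Definition wnull (u : nat -> X) : Prop :=
  weakly_null (fun x y : X => (x + y)%R) (fun a (x : X) => (a *: x)%R)
    (fun x : X => `|x|%R) u.

Definition Rcoef (a : R) : \bar R :=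
  ereal_sup [set l | exists (x : X) (u : nat -> X),
    [/\ (`|x| <= a)%R, (forall n, `|u n| <= 1)%R, wnull u,
        limn_esup (fun n => limn_esup (fun m => (`|u n - u m|)%:E)) <= 1%:E
      & l = limn_einf (fun n => (`|u n + x|)%:E)]].

(* M(X) = sup_{a >= 0} (1+a)/R(a,X)   (with the convention c/0 = +oo) *)
Definition Mcoef : \bar R :=
  ereal_sup [set ((1 + a)%R)%:E / Rcoef a | a in [set a : R | (0 <= a)%R]].
End Coeff.

Section PsiNorm.
Variables (R : realType) (r : nat) (psi : 'rV[R]_r -> R).

Definition is_norm_Rr : Prop :=
  [/\ forall x, psi x = 0 -> x = 0,
      forall (a : R) x, psi (a *: x) = `|a| * psi x &
      forall x y, psi (x + y) <= psi x + psi y].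

Definition absolute_norm : Prop := forall x, psi x = psi (map_mx (fun t : R => `|t|) x).

Definition normalized_norm : Prop := forall i : 'I_r, psi (delta_mx 0 i) = 1.

Definition strictly_monotone : Prop :=
  forall x y : 'rV[R]_r, (forall i, `|x 0 i| <= `|y 0 i|) ->
    (exists i, `|x 0 i| < `|y 0 i|) -> psi x < psi y.
End PsiNorm.

Section DirectSum.
Variables (R : realType) (r : nat) (X : 'I_r -> normedModType R)
  (psi : 'rV[R]_r -> R).

Definition psum := forall i : 'I_r, X i.
Definition psum_add (x y : psum) : psum := fun i => x i + y i.
Definition psum_scale (a : R) (x : psum) : psum := fun i => a *: x i.
Definition psum_norm (x : psum) : R := psi (\row_i `|x i|).

Definition psum_WFPP : Prop := WFPP psum_add psum_scale psum_norm.
End DirectSum.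

(* Main.v *)
From HB Require Import structures.
Require Import Defs.
From mathcomp Require Import all_boot all_order all_algebra.
From mathcomp Require Import all_classical all_reals all_analysis.
From mathcomp Require Import ring lra.
Set Implicit Arguments. Unset Strict Implicit. Unset Printing Implicit Defensive.
Import Order.TTheory GRing.Theory Num.Theory.
Import numFieldNormedType.Exports.
Local Open Scope classical_set_scope.
Local Open Scope ring_scope.

(** Suppose a fixed point free nonexpansive [T] leaves a weakly compact convex set
invariant. In a minimal such set [C], of diameter [rho > 0], take an approximate
fixed point sequence [x_n] with weak limit [xo] along a free ultrafilter [U], and
let [d_i] be the limits of the coordinate norms of [x_n - xo]. Choose
[0 < tau < rho] different from the finitely many values [psi (d 1_S)].

For [e = 1 / (k + 1)] let [w_n] be the fixed points of
[v |-> (1 - e) T v + e ((1 - tau / rho) xo + (tau / rho) x_n)]. They satisfy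
[|w_n - w_m| <= tau], [lim |w_n - x_n| <= rho - tau] and [|w_n - T w_n| <= e rho],
so by the Goebel-Karlovitz lemma [|w_n - xo|] is close to [rho] for large [k].
With [w] the weak limit of [w_n], let [b] and [c] be the limits (in [n], then in
[k]) of the coordinate norms of [w_n - w] and [w - xo]. Weak lower semicontinuity
and strict monotonicity of [psi] turn [rho <= tau + (rho - tau)] into equalities in
every coordinate. If [b_i, c_i > 0], the equalities in coordinate [i] force
[R(a, X_i) = 1 + a] for all [a], against [M(X_i) > 1]. If [c_i = 0], then [w_n] and
[x_n] have the same limit behaviour in coordinate [i], so [b_i = d_i]. Hence
[b = d 1_S] with [S = {i | c_i = 0}] and [psi b = tau], which contradicts the
choice of [tau]. *)

(** * Sublinear functionals and separation *)

Section Sublinear.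
Variables (R : realType) (V : lmodType R).
Implicit Types (p q : V -> R) (x y : V).

Definition sublinear p : Prop :=
  (forall x y, p (x + y) <= p x + p y) /\
  (forall a x, 0 <= a -> p (a *: x) <= a * p x).

Lemma sublinear0 p : sublinear p -> p 0 = 0.
Proof.
move=> [pD pZ]; apply/eqP; rewrite eq_le; apply/andP; split.
  by have := pZ 0 0 (lexx _); rewrite scale0r mul0r.
by have := pD 0 0; rewrite addr0; lra.
Qed.

Lemma sublinearN p x : sublinear p -> - p (- x) <= p x.
Proof.
by move=> ps; have := ps.1 x (- x); rewrite subrr (sublinear0 ps); lra.
Qed.

Lemma inf_le_image (I : Type) (D : set I) (F : I -> R) (B : R) (i : I) :
  (forall i, D i -> B <= F i) -> D i -> inf [set F j | j in D] <= F i.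
Proof.
move=> FB Di; apply: ge_inf; last by exists i.
by exists B => _ [j Dj <-]; exact: FB.
Qed.

(** Near-minimizing indices for [x] and [y] combine into one for [x + y]. Since that index may vary,
    chains, directional lowering and separation are all covered. *)
Lemma inf_sublinear (I : Type) (D : set I) (F : I -> V -> R) :
  D !=set0 ->
  (forall x, exists B, forall i, D i -> B <= F i x) ->
  (forall i j x y, D i -> D j -> exists2 k, D k & F k (x + y) <= F i x + F j y) ->
  (forall i a x, D i -> 0 <= a -> exists2 k, D k & F k (a *: x) <= a * F i x) ->
  sublinear (fun x => inf [set F i x | i in D]).
Proof.
move=> [i0 Di0] Flb FD FZ.
have Finf x : has_inf [set F i x | i in D].
  split; first by exists (F i0 x), i0.
  by have [B FB] := Flb x; exists B => _ [i Di <-]; exact: FB.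
have infF i x : D i -> inf [set F j x | j in D] <= F i x.
  by have [B FB] := Flb x; exact: (@inf_le_image _ D (F^~ x) B).
split=> [x y|a x a0].
  apply/ler_addgt0Pr => e e0; have e20 : 0 < e / 2 by rewrite divr_gt0.
  have [_ [i Di <-] Fi] := inf_adherent e20 (Finf x).
  have [_ [j Dj <-] Fj] := inf_adherent e20 (Finf y).
  have [k Dk Fk] := FD i j x y Di Dj.
  by have := infF k (x + y) Dk; lra.
apply/ler_addgt0Pr => e e0.
have e20 : 0 < e / (1 + a) by rewrite divr_gt0// ltr_pwDl.
have [_ [i Di <-] Fi] := inf_adherent e20 (Finf x).
have [k Dk Fk] := FZ i a x Di a0.
have ae : a * (e / (1 + a)) <= e.
  by rewrite mulrA ler_pdivrMr//; lra.
apply: (le_trans (infF k _ Dk)); apply: (le_trans Fk).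
by apply: (@le_trans _ _ (a * inf [set F j x | j in D] + a * (e / (1 + a))));
  [rewrite -mulrDr ler_wpM2l// ltW | rewrite lerD2l].
Qed.

(** Lowering [q] in the direction [x] gives a sublinear functional below [q], hence [q] itself; its
    value at [- x] is at most the term with [l = 1], which is [- q x]. *)
Lemma minimal_sublinear_opp q x :
  sublinear q ->
  (forall q', sublinear q' -> (forall y, q' y <= q y) -> forall y, q' y = q y) ->
  q (- x) = - q x.
Proof.
move=> qs qmin; have [qD qZ] := qs.
have lb y l : 0 <= l -> - q (- y) <= q (y + l *: x) - l * q x.
  move=> l0; have := qD (y + l *: x) (- y); rewrite addrAC subrr add0r.
  have -> : q (l *: x) = l * q x; last lra.
  apply/eqP; rewrite eq_le qZ//=.
  have [->|ln0] := eqVneq l 0; first by rewrite mul0r scale0r (sublinear0 qs).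
  have lp : 0 < l by rewrite lt_neqAle eq_sym ln0.
  have := qZ l^-1 (l *: x); rewrite invr_ge0 scalerA mulVf// scale1r => /(_ l0).
  by rewrite -(ler_pM2l lp) mulrA mulfV// mul1r.
have q0 y : inf [set q (y + l *: x) - l * q x | l in [set l | 0 <= l]] <= q y.
  have := @inf_le_image _ _ (fun l => q (y + l *: x) - l * q x) _ 0 (lb y).
  by rewrite /= scale0r mul0r addr0 subr0; apply.
have qE := qmin _ (inf_sublinear _ _ _ _) q0.
apply/eqP; rewrite eq_le; apply/andP; split; last first.
  by have := sublinearN (- x) qs; rewrite opprK; lra.
rewrite -qE.
- have := @inf_le_image _ _ (fun l => q (- x + l *: x) - l * q x) _ 1 (lb (- x)).
  by rewrite /= scale1r mul1r addNr (sublinear0 qs) sub0r; apply.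
- by exists 0 => /=.
- by move=> y; exists (- q (- y)) => l; exact: lb.
- move=> l m y z /= l0 m0; exists (l + m); first by rewrite /= addr_ge0.
  rewrite scalerDl addrACA mulrDl; have := qD (y + l *: x) (z + m *: x); lra.
- move=> l a y /= l0 a0; exists (a * l); first by rewrite /= mulr_ge0.
  rewrite -scalerA -scalerDr mulrBr mulrA.
  by rewrite lerB// qZ.
Qed.

(* A minimal sublinear functional is linear: for any [x], lowering [q] in the
   direction [x] by [y |-> inf_(l >= 0) (q (y + l x) - l q x)] changes nothing. *)
Lemma linear_le_sublinear p : sublinear p ->
  exists f : V -> R,
    (forall a x y, f (a *: x + y) = a * f x + f y) /\ (forall x, f x <= p x).
Proof.
move=> ps.
pose T := {q : V -> R | sublinear q /\ forall x, q x <= p x}.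
(* The order is reversed, so that a maximal element for [Zorn] is a minimal sublinear functional
   below [p]. *)
pose Rel (s t : T) := `[< forall x, sval t x <= sval s x >].
have [|||A totA|[q [qs qp]] qmax] := @Zorn T Rel.
- by move=> t; apply/asboolP.
- move=> r s t /asboolP rs /asboolP st; apply/asboolP => x.
  exact: le_trans (st x) (rs x).
- move=> [s hs] [t ht] /asboolP/= st /asboolP/= ts; apply: eq_exist => /=.
  by apply/funext => x; apply/eqP; rewrite eq_le ts st.
- have [->|/set0P[s0 As0]] := eqVneq A set0.
    by exists (exist _ p (conj ps (fun x => lexx _))).
  have lb x (s : T) : A s -> - p (- x) <= sval s x.
    move=> _; have [ss sp] := svalP s.
    by apply: le_trans (sublinearN x ss); rewrite lerN2.
  pose g x := inf [set sval s x | s in A].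
  have gs s x : A s -> g x <= sval s x.
    by move=> As; exact: (@inf_le_image _ _ _ _ _ (lb x)).
  have gsub : sublinear g.
    apply: inf_sublinear; first by exists s0.
    + by move=> x; exists (- p (- x)) => s; exact: lb.
    + move=> s t x y As At.
      have [/asboolP st|/asboolP ts] := totA _ _ As At.
        exists t => //; apply: (le_trans ((svalP t).1.1 x y)).
        by rewrite lerD2r.
      exists s => //; apply: (le_trans ((svalP s).1.1 x y)).
      by rewrite lerD2l.
    + move=> s a x As a0; exists s => //.
      exact: (svalP s).1.2.
  have gp x : g x <= p x by apply: le_trans (gs _ _ As0) _; exact: (svalP s0).2.
  by exists (exist _ g (conj gsub gp)) => s As; apply/asboolP => x; exact: gs.
- have qmin q' : sublinear q' -> (forall y, q' y <= q y) -> forall y, q' y = q y.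
    move=> q's q'q y.
    have q'p x : q' x <= p x by exact: le_trans (q'q x) (qp x).
    have := qmax (exist _ q' (conj q's q'p)).
    by move=> /(_ _)/(congr1 sval)/= ->//; apply/asboolP.
  have qN x := @minimal_sublinear_opp q x qs qmin.
  exists q; split => // a x y; have [qD qZ] := qs.
  have qD' u v : q (u + v) = q u + q v.
    apply/eqP; rewrite eq_le qD/=.
    by have := qD (u + v) (- v); rewrite addrK qN; lra.
  rewrite qD'; congr (_ + _).
  have qZ1 b u : 0 <= b -> q (b *: u) = b * q u.
    move=> b0; apply/eqP; rewrite eq_le qZ//=.
    by have := qZ b (- u) b0; rewrite scalerN !qN mulrN lerN2.
  have [a0|/ltW a0] := leP 0 a; first exact: qZ1.
  by rewrite -[in LHS](opprK a) scaleNr qN qZ1 ?oppr_ge0// mulNr opprK.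
Qed.

End Sublinear.

Section Separation.
Variables (R : realType) (V : normedModType R).

(** Hahn-Banach for the infimum of [|v + l (k - x0)| - l d] over [l >= 0] and [k] in [K]: terms with
    [l = 0] bound [f] by the norm, and [l = 1] at [v = - (k - x0)] gives the separation. *)
Lemma convex_separation (K : set V) (x0 : V) (d : R) :
  K !=set0 -> Defs.convex_set +%R *:%R K -> 0 <= d ->
  (forall k, K k -> d <= `|k - x0|) ->
  exists f : V -> R,
    [/\ forall a x y, f (a *: x + y) = a * f x + f y,
        forall x, `|f x| <= `|x| & forall k, K k -> d <= f (k - x0)].
Proof.
move=> [k0 Kk0] Kc d0 Kd.
pose D := [set lk : R * V | 0 <= lk.1 /\ K lk.2].
pose F (lk : R * V) (v : V) := `|v + lk.1 *: (lk.2 - x0)| - lk.1 * d.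
have lb v lk : D lk -> - `|v| <= F lk v.
  move=> [l0 Kk]; rewrite /F.
  have : lk.1 * d <= `|lk.1 *: (lk.2 - x0)|.
    by rewrite normrZ ger0_norm// ler_wpM2l// Kd.
  have := ler_normD (v + lk.1 *: (lk.2 - x0)) (- v).
  by rewrite addrAC subrr add0r normrN; lra.
have pF v lk : D lk -> inf [set F i v | i in D] <= F lk v.
  move=> Dlk; apply: (@inf_le_image _ _ _ (F^~ v) (- `|v|)) => //.
  by move=> i; exact: lb.
have [||||f [flin fp]] := linear_le_sublinear (@inf_sublinear _ _ _ D F _ _ _ _).
- by exists (0, k0); split=> //=.
- by move=> v; exists (- `|v|) => i; exact: lb.
- move=> [l k] [m k'] u v [/= l0 Kk] [/= m0 Kk'].
  (* The combined index is [l + m] with the weighted mean of [k] and [k'], which has no meaning when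
     both weights vanish. *)
  have [lm0|lmn0] := eqVneq (l + m) 0.
    have [l00 m00] : l = 0 /\ m = 0 by split; lra.
    exists (0, k); first by [].
    by rewrite /F /= l00 m00 !scale0r !addr0 !mul0r !subr0 ler_normD.
  have lmp : 0 < l + m by rewrite lt_neqAle eq_sym lmn0 addr_ge0.
  exists (l + m, (l / (l + m)) *: k + (1 - l / (l + m)) *: k').
    split; rewrite /= ?addr_ge0//; apply: Kc => //.
      by rewrite divr_ge0// addr_ge0.
    by rewrite ler_pdivrMr//; lra.
  rewrite /F /=.
  have -> : (l + m) *: (l / (l + m) *: k + (1 - l / (l + m)) *: k' - x0) =
      l *: (k - x0) + m *: (k' - x0).
    rewrite !scalerBr !scalerDr !scalerA.
    have -> : (l + m) * (l / (l + m)) = l by field.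
    have -> : (l + m) * (1 - l / (l + m)) = m by field.
    by rewrite scalerDl opprD addrACA.
  rewrite addrACA.
  by have := ler_normD (u + l *: (k - x0)) (v + m *: (k' - x0)); lra.
- move=> [l k] a u [/= l0 Kk] a0; exists (a * l, k); first by split=> //=; rewrite mulr_ge0.
  rewrite /F /= -scalerA -scalerDr normrZ ger0_norm// -mulrA.
  by rewrite mulrBr.
have fN x : f (- x) = - f x.
  have f0 : f 0 = 0.
    by have := flin 1 0 0; rewrite scale1r addr0; lra.
  by have := flin (-1) x 0; rewrite scaleN1r addr0 f0; lra.
have f1 x : f x <= `|x|.
  apply: le_trans (fp x) _; apply: le_trans (pF x (0, k0) _) _; first by split=> /=.
  by rewrite /F /= scale0r mul0r addr0 subr0.
exists f; split => //.
  by move=> x; rewrite ler_norml f1 andbT -[leRHS]opprK -fN lerN2 -normrN f1.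
move=> k Kk; rewrite -lerN2 -fN; apply: le_trans (fp _) _.
apply: le_trans (pF _ (1, k) _) _; first by split=> /=.
by rewrite /F /= scale1r mul1r addNr normr0 sub0r.
Qed.

Lemma norming_functional (x : V) :
  exists f : V -> R,
    [/\ forall a y z, f (a *: y + z) = a * f y + f z,
        forall y, `|f y| <= `|y| & f x = `|x|].
Proof.
have [||||f [fl f1 fx]] := @convex_separation [set x] 0 `|x|.
- by exists x.
- move=> _ _ t -> -> _ _ /=.
  by rewrite -scalerDl addrC subrK scale1r.
- exact: normr_ge0.
- by move=> _ ->; rewrite subr0.
exists f; split => //; apply/eqP; rewrite eq_le.
by rewrite (le_trans (ler_norm _) (f1 x))/= -{2}[x]subr0 fx.
Qed.

End Separation.

(** * Weak limits and the Eberlein-Smulian extraction *)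

Lemma le_cvg_lim (R : realType) (T : Type) (F : set_system T) {FF : ProperFilter F}
    (f g : T -> R) (l m : R) :
  f x @[x --> F] --> l -> g x @[x --> F] --> m ->
  (forall x, f x <= g x) -> l <= m.
Proof.
move=> fl gm fg; rewrite -subr_ge0.
apply: (cvgr_to_ge (cvgB gm fl)).
by apply: nearW => x /=; rewrite subr_ge0.
Qed.

Section WeakLimits.
Variables (R : realType) (V : normedModType R).
Implicit Types (f : V -> R) (u : nat -> V) (x y : V) (F : set_system nat).

Local Notation cfun := (@cont_functional R V +%R *:%R Num.norm).
Local Notation wcompact := (@weakly_compact R V +%R *:%R Num.norm).

Definition wcvg F u x := forall f, cfun f -> f (u n) @[n --> F] --> f x.

Lemma cfunB f x y : cfun f -> f (x - y) = f x - f y.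
Proof. by move=> [fl _]; have := fl (-1) y x; rewrite scaleN1r addrC; lra. Qed.

Lemma cfun_norm1 f : (forall a x y, f (a *: x + y) = a * f x + f y) ->
  (forall x, `|f x| <= `|x|) -> cfun f.
Proof. by move=> fl f1; split => //; exists 1 => x; rewrite mul1r. Qed.

Lemma wcvg_sub F {FF : Filter F} u v x y :
  wcvg F u x -> wcvg F v y -> wcvg F (fun n => u n - v n) (x - y).
Proof.
move=> ux vy f cf; rewrite cfunB//.
under eq_fun do rewrite cfunB//.
exact: cvgB (ux f cf) (vy f cf).
Qed.

Lemma wcvg_cst F {FF : Filter F} x : wcvg F (fun=> x) x.
Proof. by move=> f _; exact: cvg_cst. Qed.

Lemma closed_normP (K : set V) : closed K <->
  forall x, (forall e, 0 < e -> exists2 k, K k & `|x - k| < e) -> K x.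
Proof.
split=> [cK x xK|xK].
  apply: cK => B /nbhs_ballP[e /= e0 xB].
  have [k Kk xk] := xK _ e0; exists k; split => //; apply: xB.
  by rewrite -ball_normE.
move=> x clx; apply: xK => e e0.
have [k [Kk xk]] := clx _ (nbhsx_ballx x e e0); exists k => //.
by move: xk; rewrite -ball_normE.
Qed.

(** Mazur: a point outside [K] has positive distance from it, and one separating functional keeps
    all of [K] at least that far away. *)
Lemma closed_convex_weak (K : set V) x :
  closed K -> Defs.convex_set +%R *:%R K -> K !=set0 ->
  (forall f, cfun f -> forall e, 0 < e -> exists2 k, K k & `|f k - f x| < e) -> K x.
Proof.
move=> /closed_normP cK convK K0 Kx; apply: cK => e e0.
apply: contrapT => nKx.
have far k : K k -> e <= `|k - x|.
  move=> Kk; rewrite leNgt; apply/negP => ke; apply: nKx.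
  by exists k => //; rewrite distrC.
have [|f [fl f1 fe]] := convex_separation K0 convK _ far; first exact: ltW.
have cf := cfun_norm1 fl f1.
have [k Kk fk] := Kx f cf e e0.
have := fe _ Kk; rewrite cfunB// leNgt => /negP; apply.
by rewrite (le_lt_trans _ fk)// ler_norm.
Qed.

Lemma wcvg_closed F {FF : ProperFilter F} (K : set V) u x :
  closed K -> Defs.convex_set +%R *:%R K ->
  (\forall n \near F, K (u n)) -> wcvg F u x -> K x.
Proof.
move=> cK convK FK ux; apply: closed_convex_weak => //.
  by have [n Kn] := filter_ex FK; exists (u n).
move=> f cf e e0; have /cvgrPdist_lt/(_ _ e0) fux := ux f cf.
by have [n [Kn /= un]] := filter_ex (filterI FK fux); exists (u n); rewrite // distrC.
Qed.

Lemma weak_cluster_closed (F : set_system V) (K : set V) x :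
  proper_filter F -> closed K -> Defs.convex_set +%R *:%R K -> F K ->
  @weak_cluster R V +%R *:%R Num.norm F x -> K x.
Proof.
move=> [_ F0 _ FS] cK convK FK Fx; apply: closed_convex_weak => //.
  by apply/set0P/eqP => K0; apply: F0; rewrite -K0.
move=> f cf e e0; have [//|y [Ky]] := Fx 1%N (fun=> f) _ e e0 K FK.
by move=> /(_ ord0) fy; exists y.
Qed.

(** Weak lower semicontinuity of the norm, tested on a norming functional of [x - y]. *)
Lemma wcvg_norm_le F {FF : ProperFilter F} u x y (l : R) :
  wcvg F u x -> `|u n - y| @[n --> F] --> l -> `|x - y| <= l.
Proof.
move=> ux ul.
have [f [fl f1 fxy]] := norming_functional (x - y).
have cf := cfun_norm1 fl f1.
have fuy : f (u n - y) @[n --> F] --> `|x - y|.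
  by rewrite -fxy; apply: (wcvg_sub ux) => //; exact: wcvg_cst.
apply: (le_cvg_lim fuy ul).
by move=> n; exact: le_trans (ler_norm _) (f1 _).
Qed.

Lemma proper_filter_fmap (F : set_system nat) {FF : ProperFilter F} (u : nat -> V) :
  proper_filter (u @ F).
Proof.
split; rewrite /fmap/=.
- exact: filterT.
- exact: filter_not_empty.
- by move=> A B; exact: filterI.
- by move=> A B AB; apply: filterS => n; exact: AB.
Qed.

(** For an ultrafilter clustering is convergence: a neighbourhood whose preimage is not in [U] has
    its complement there, which the cluster point excludes. *)
Lemma wcompact_wcvg (C : set V) U {UU : UltraFilter U} u :
  wcompact C -> (forall n, C (u n)) -> exists2 x, C x & wcvg U u x.
Proof.
move=> wC Cu.
have [|x [Cx xU]] := wC _ (@proper_filter_fmap U _ u).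
  by rewrite /fmap/=; apply: filterS filterT => n _; exact: Cu.
exists x => // f cf; apply/cvgrPdist_lt => e e0.
have [//|far] := in_ultra_setVsetC [set n | `|f x - f (u n)| < e] UU.
have [||y [fy]] := xU 1%N (fun=> f) _ e e0 [set y | ~ `|f x - f y| < e].
- by [].
- exact: far.
by move=> /(_ ord0); rewrite distrC => /fy.
Qed.

End WeakLimits.

Lemma ultra_cvg (R : realType) U {UU : UltraFilter U} (f : nat -> R) (B : R) :
  (forall n, `|f n| <= B) -> cvg (f @ U).
Proof.
move=> fB.
have := @segment_compact R (- B) B; rewrite compact_ultra => cpt.
have UF : UltraFilter (f @ U).
  have PF : ProperFilter (f @ U) by exact: fmap_proper_filter.
  split=> // G PG UG; apply/seteqP; split; last exact: UG.
  move=> A GA; have [//|nA] := in_ultra_setVsetC (f @^-1` A) UU.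
  by have [x []] := filter_ex (filterI GA (UG (~` A) nA)).
have [|x [_ fx]] := cpt _ UF; last first.
  by apply/cvg_ex; exists x; exact: fx.
have : \forall n \near U, - B <= f n <= B by apply: nearW => n; rewrite -ler_norml.
by apply: filterS => n /=; rewrite in_itv.
Qed.

Section Eberlein.
Variables (R : realType) (V : normedModType R).
Implicit Types (f : V -> R) (u : nat -> V) (x y : V).

Local Notation cfun := (@cont_functional R V +%R *:%R Num.norm).
Local Notation wcompact := (@weakly_compact R V +%R *:%R Num.norm).

(** Rational coefficients make the combinations countable, so that [unpickle] can enumerate them in
    [rat_span_norming]. *)
Definition rat_comb u (s : seq (rat * nat)) : V :=
  \sum_(p <- s) (ratr p.1 : R) *: u p.2.

Definition rat_span u : set V :=
  [set v | forall e : R, 0 < e -> exists s, `|v - rat_comb u s| < e].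

Lemma rat_span_mem u n : rat_span u (u n).
Proof.
move=> e e0; exists [:: (1%Q, n)].
by rewrite /rat_comb big_seq1 rmorph1 scale1r subrr normr0.
Qed.

Lemma rat_spanD u x y : rat_span u x -> rat_span u y -> rat_span u (x + y).
Proof.
move=> xu yu e e0; have e20 : 0 < e / 2 by rewrite divr_gt0.
have [s xs] := xu _ e20; have [t yt] := yu _ e20.
exists (s ++ t); rewrite /rat_comb big_cat/= opprD addrACA.
by apply: le_lt_trans (ler_normD _ _) _; move: xs yt; rewrite /rat_comb; lra.
Qed.

Lemma rat_spanZ u a x : rat_span u x -> rat_span u (a *: x).
Proof.
move=> xu e e0.
have a0 : 0 < 1 + `|a| by rewrite ltr_pwDl.
have [|s xs] := xu (e / 2 / (1 + `|a|)); first by rewrite !divr_gt0.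
pose d := rat_comb u s.
have d0 : 0 < 1 + `|d| by rewrite ltr_pwDl.
pose h := e / 2 / (1 + `|d|).
have h0 : 0 < h by rewrite !divr_gt0.
(* A rational [q] replaces the real factor [a]; the choice of [h] keeps the resulting error at most
   [e / 2]. *)
have [q] := @rat_in_itvoo R (a - h) (a + h) ltac:(lra).
rewrite in_itv/= => /andP[aq qa].
exists [seq (q * p.1, p.2) | p <- s].
have -> : rat_comb u [seq (q * p.1, p.2) | p <- s] = ratr q *: d.
  rewrite /rat_comb big_map scaler_sumr; apply: eq_bigr => p _ /=.
  by rewrite rmorphM scalerA.
have -> : a *: x - ratr q *: d = a *: (x - d) + (a - ratr q) *: d.
  by rewrite scalerBr scalerBl addrA subrK.
apply: le_lt_trans (ler_normD _ _) _; rewrite !normrZ.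
have -> : e = e / 2 + e / 2 by lra.
apply: ltr_leD.
  have [->|an0] := eqVneq a 0; first by rewrite normr0 mul0r divr_gt0.
  apply: (@lt_trans _ _ (`|a| * (e / 2 / (1 + `|a|)))).
    by rewrite ltr_pM2l ?normr_gt0.
  by rewrite mulrA ltr_pdivrMr//; nra.
have aqh : `|a - ratr q| <= h by rewrite ler_norml; lra.
apply: (@le_trans _ _ (h * `|d|)); first by rewrite ler_wpM2r.
by rewrite /h mulrAC ler_pdivrMr//; nra.
Qed.

Lemma closed_rat_span u : closed (rat_span u).
Proof.
apply/closed_normP => x xu e e0; have e20 : 0 < e / 2 by rewrite divr_gt0.
have [y yu xy] := xu _ e20; have [s ys] := yu _ e20; exists s.
apply: le_lt_trans (ler_distD y _ _) _; lra.
Qed.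

Lemma convex_rat_span u : Defs.convex_set +%R *:%R (rat_span u).
Proof. by move=> x y t ux uy _ _; apply: rat_spanD; exact: rat_spanZ. Qed.

(** Norming functionals of the rational combinations suffice: if all vanish at [v] and [d] is a
    combination close to [v], then [|d| = f d - f v <= |d - v|], so [|v|] is arbitrarily small. *)
Lemma rat_span_norming u : exists f : nat -> V -> R,
  (forall j, cfun (f j)) /\
  forall v, rat_span u v -> (forall j, f j v = 0) -> v = 0.
Proof.
have /choice[g gP] : forall v : V, exists f : V -> R,
    [/\ forall a y z, f (a *: y + z) = a * f y + f z,
        forall y, `|f y| <= `|y| & f v = `|v|] by exact: norming_functional.
exists (fun j => g (rat_comb u (odflt [::] (unpickle j)))); split.
  by move=> j; have [fl f1 _] := gP (rat_comb u (odflt [::] (unpickle j))); exact: cfun_norm1.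
move=> v vu fv; apply/eqP; rewrite -normr_le0; apply/ler_addgt0Pr => e e0.
rewrite add0r; have e20 : 0 < e / 2 by rewrite divr_gt0.
have [s vs] := vu _ e20.
have := fv (pickle s); rewrite pickleK/=.
have [fl f1 fs] := gP (rat_comb u s) => fv0.
have := cfunB (rat_comb u s) v (cfun_norm1 fl f1); rewrite fv0 subr0 fs => E.
have := f1 (rat_comb u s - v); rewrite E normr_id distrC => sv.
have := ler_normD (v - rat_comb u s) (rat_comb u s); rewrite subrK; lra.
Qed.

(** Each new index has to meet only finitely many conditions, every one of which holds on a member
    of [U]. *)
Lemma sequential_selection (Q : nat -> nat -> Prop) (P : nat -> nat -> Prop)
    U {UU : UltraFilter U} :
  (forall k, U (Q k)) -> (forall k n, Q k n -> U (P n)) ->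
  exists phi : nat -> nat, (forall k, Q k (phi k)) /\
    forall l k, (l < k)%N -> P (phi l) (phi k).
Proof.
move=> UQ UP.
pose S (s : seq nat) n := Q (size s) n /\ forall m, m \in s -> P m n.
(* [sel] is arbitrary where no admissible index exists; [exS] with [LQ] rules this out for the lists
   [L k] of earlier choices. *)
have /choice[sel selP] : forall s : seq nat, exists n, (exists m, S s m) -> S s n.
  move=> s; have [[m Sm]|nS] := pselect (exists m, S s m); first by exists m.
  by exists 0%N => /nS.
pose L := fix L k := if k is k'.+1 then rcons (L k') (sel (L k')) else [::].
have sL k : size (L k) = k by elim: k => //= k IH; rewrite size_rcons IH.
have exS s : (forall m, m \in s -> exists j, Q j m) -> exists m, S s m.
  move=> sQ; suff : U [set m | forall n, n \in s -> P n m].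
    move=> Us; have [m [Qm sm]] := filter_ex (filterI (UQ (size s)) Us).
    by exists m.
  elim: s sQ => [|n s IH] sQ; first by apply: filterS filterT.
  have [j Qn] := sQ n (mem_head _ _).
  have Us := IH (fun m ms => sQ m (@mem_behead _ (n :: s) m ms)).
  apply: filterS (filterI (UP _ _ Qn) Us) => m [Pnm sm] n'.
  by rewrite inE => /orP[/eqP->|/sm].
have LQ k : forall m, m \in L k -> exists j, Q j m.
  elim: k => [|k IH] m //=; rewrite mem_rcons inE => /orP[/eqP->|/IH//].
  by have [Qm _] := selP _ (exS _ IH); exists (size (L k)).
exists (fun k => sel (L k)); split=> [k|l k lk].
  by have [+ _] := selP _ (exS _ (LQ k)); rewrite sL.
have [_ +] := selP _ (exS _ (LQ k)); apply.
elim: k lk => // k IH; rewrite ltnS leq_eqVlt => /orP[/eqP->|/IH lk] /=.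
  by rewrite mem_rcons mem_head.
by rewrite mem_rcons inE lk orbT.
Qed.

(* Eberlein-Smulian, with room for further requirements on the subsequence:
   countably many functionals separate the points of the closed span of [u], so
   convergence of these already forces weak convergence along [phi]. *)
Lemma weak_extraction (C : set V) U {UU : UltraFilter U} u x (A : set nat)
    (P : nat -> nat -> Prop) :
  wcompact C -> (forall n, C (u n)) -> wcvg U u x ->
  U A -> (forall n, A n -> U (P n)) ->
  exists phi : nat -> nat, [/\ forall k, A (phi k),
    forall l k, (l < k)%N -> P (phi l) (phi k) & wcvg \oo (u \o phi) x].
Proof.
move=> wC Cu ux UA UP.
have [g [gc gsep]] := rat_span_norming u.
(* The k-th index approximates the first [k] functionals at [x] within [1 / (k + 1)], which forces
   convergence of each single one. *)
pose Q k n := A n /\ forall j, (j < k)%N -> `|g j x - g j (u n)| < k.+1%:R^-1.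
have UQ k : U (Q k).
  apply: filterI => //.
  have UQj i : U [set n | forall j, (j < i)%N -> `|g j x - g j (u n)| < k.+1%:R^-1].
    elim: i => [|i IH]; first by apply: filterS filterT.
    have /cvgrPdist_lt/(_ k.+1%:R^-1) := ux _ (gc i).
    rewrite invr_gt0 ltr0n => /(_ isT) Ui.
    apply: filterS (filterI IH Ui) => n [IHn Un] j.
    by rewrite ltnS leq_eqVlt => /orP[/eqP->|/IHn].
  exact: UQj.
have [phi [phiQ phiP]] := sequential_selection UQ (fun k n (Qn : Q k n) => UP n Qn.1).
exists phi; split => // [k|f cf]; first exact: (phiQ k).1.
have gphi j : g j (u (phi n)) @[n --> \oo] --> g j x.
  apply/cvgrPdist_lt => e e0.
  have /cvgrPdist_lt/(_ _ e0)[N _ Ne] := @cvg_harmonic R.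
  exists (maxn N j.+1) => // n; rewrite /= geq_max => /andP[Nn jn].
  apply: lt_trans ((phiQ n).2 j jn) _.
  by have := Ne n Nn; rewrite /harmonic sub0r normrN ger0_norm// invr_ge0.
(* Otherwise [f] stays at distance [e] from [f x] along infinitely many indices. An ultrafilter on
   these gives a weak limit [y] in the closed span with the same values under every [g j] as [x], so
   [y = x], a contradiction. *)
apply: contrapT => nfx.
have [e e0 far] : exists2 e, 0 < e & forall N, exists2 k, (N <= k)%N &
    e <= `|f x - f (u (phi k))|.
  apply: contrapT => H; apply: nfx; apply/cvgrPdist_lt => e e0.
  apply: contrapT => H'; apply: H; exists e => // N.
  apply: contrapT => H2; apply: H'; exists N => // k /= Nk.
  by rewrite ltNge; apply/negP => ek; apply: H2; exists k.
pose W := within [set k | e <= `|f x - f (u (phi k))|] \oo.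
have PW : ProperFilter W.
  apply: Build_ProperFilter_ex.
  move=> B [N _ NB]; have [k Nk ek] := far N.
  by exists k; exact: NB.
have [W' [UW' WW']] := ultraFilterLemma PW.
have ooW B : \oo B -> W' B.
  by move=> ooB; apply: WW'; apply: filterS ooB => k Bk _.
have [y Cy yW] := wcompact_wcvg wC (fun n => Cu (phi n)) (U := W').
have gyx j : g j y = g j x.
  apply: (@cvg_unique _ _ _ _ _ _ (yW _ (gc j))) => //.
  by move=> B /(gphi j)/ooW.
have spany : rat_span u y.
  apply: (wcvg_closed (@closed_rat_span u) (@convex_rat_span u) _ yW).
  by apply: nearW => n; exact: rat_span_mem.
have spanx : rat_span u x.
  apply: (wcvg_closed (@closed_rat_span u) (@convex_rat_span u) _ ux).
  by apply: nearW => n; exact: rat_span_mem.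
have /eqP : y - x = 0.
  apply: gsep.
    by apply: rat_spanD => //; rewrite -scaleN1r; exact: rat_spanZ.
  by move=> j; rewrite cfunB// gyx subrr.
rewrite subr_eq0 => /eqP yx; move: yW; rewrite yx => /(_ f cf).
move=> /cvgrPdist_lt/(_ _ e0) near.
have Wfar : W' [set k | e <= `|f x - f (u (phi k))|].
  by apply: WW'; exact: nearW.
have [k [/=]] := filter_ex (filterI near Wfar).
by rewrite ltNge => /negP.
Qed.

End Eberlein.

(** * Weakly compact convex sets *)

Lemma free_ultrafilter : exists2 U : set_system nat, UltraFilter U & \oo `<=` U.
Proof. by have [U [UU ooU]] := @ultraFilterLemma nat \oo _; exists U. Qed.

Section WeaklyCompact.
Variables (R : realType) (V : normedModType R).
Implicit Types (f : V -> R) (x y : V) (C K : set V).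

Local Notation cfun := (@cont_functional R V +%R *:%R Num.norm).
Local Notation wcompact := (@weakly_compact R V +%R *:%R Num.norm).
Local Notation convex := (@Defs.convex_set R V +%R *:%R).

(** Points where [f] exceeds [n] in modulus would have a weak limit along a free ultrafilter, where
    the values of [f] converge. *)
Lemma wcompact_cfun_bounded C f : wcompact C -> cfun f ->
  exists M : R, forall x, C x -> `|f x| <= M.
Proof.
move=> wC cf; apply: contrapT => nb.
have /choice[u uP] : forall n : nat, exists x, C x /\ n%:R < `|f x|.
  move=> n; apply: contrapT => H; apply: nb; exists n%:R => x Cx.
  by rewrite leNgt; apply/negP => nx; apply: H; exists x.
have [U UU ooU] := free_ultrafilter.
have [x Cx ux] := wcompact_wcvg wC (fun n => (uP n).1) (U := U).
have /cvgrPdist_lt/(_ 1 ltr01) fux := ux f cf.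
have big : U [set n | `|f x| + 1 <= n%:R].
  by apply: ooU; exact: nbhs_infty_ger.
have [n [/= fn xn]] := filter_ex (filterI fux big).
have := (uP n).2; have := ler_normB (f x) (f x - f (u n)).
by rewrite opprB addrC subrK; lra.
Qed.

Lemma wcompact_bounded C : wcompact C -> exists M : R, forall x, C x -> `|x| <= M.
Proof.
(* gliding hump: if [C] is unbounded, some [sum_n 4^-n g_n], with norming
   functionals [g_n] of rapidly growing points of [C], is unbounded on [C] *)
move=> wC; apply: contrapT => nb.
have /choice[g gP] : forall v : V, exists f : V -> R,
    [/\ forall a y z, f (a *: y + z) = a * f y + f z,
        forall y, `|f y| <= `|y| & f v = `|v|] by exact: norming_functional.
pose q n : R := 4^-1 ^+ n.
have q0 n : 0 < q n by rewrite exprn_gt0.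
(* The factor [2 / 3] is what the tail leaves of the n-th term, since [sum_(i > n) 4^-i = 4^-n / 3].
   Hence the limit functional is at least [n] at the chosen point. *)
have /choice[sel selP] : forall nh : nat * (V -> R), exists u, cfun nh.2 ->
    C u /\ forall v, C v -> nh.1%:R + `|nh.2 v| <= 2 / 3 * (q nh.1 * `|u|).
  move=> [n h] /=; have [ch|nch] := pselect (cfun h); last by exists 0.
  have [M hM] := wcompact_cfun_bounded wC ch.
  have [u [Cu uM]] : exists u, C u /\ (n%:R + M) * (3 / 2) / q n < `|u|.
    apply: contrapT => H; apply: nb; exists ((n%:R + M) * (3 / 2) / q n) => x Cx.
    by rewrite leNgt; apply/negP => nx; apply: H; exists x.
  exists u => _; split => // v Cv; have := hM v Cv.
  by move: uM; rewrite ltr_pdivrMr// mulrC [X in _ < X]mulrC; lra.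
pose G := fix G n : V -> R :=
  if n is m.+1 then fun v => G m v + q m * g (sel (m, G m)) v else fun=> 0.
have Glin n a x y : G n (a *: x + y) = a * G n x + G n y.
  elim: n => [|n IH] /=; first by rewrite mulr0 addr0.
  by have [-> _ _] := gP (sel (n, G n)); rewrite IH; ring.
have Gdist m i v : `|G (m + i)%N v - G m v| <= 4 / 3 * (q m - q (m + i)%N) * `|v|.
  elim: i => [|i IH]; first by rewrite addn0 !subrr normr0 mulr0 mul0r.
  rewrite addnS /= addrAC; apply: le_trans (ler_normD _ _) _.
  have [_ g1 _] := gP (sel ((m + i)%N, G (m + i)%N)).
  rewrite normrM gtr0_norm//; have := ler_wpM2l (ltW (q0 (m + i)%N)) (g1 v).
  have -> : q (m + i).+1 = q (m + i)%N / 4 by rewrite /q exprSr.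
  lra.
have Gbound m n v : (m <= n)%N -> `|G n v - G m v| <= 4 / 3 * q m * `|v|.
  move=> mn; rewrite -(subnKC mn); apply: le_trans (Gdist _ _ _) _.
  by rewrite ler_wpM2r// ler_wpM2l// gerBl ltW.
have cG n : cfun (G n).
  split; first exact: Glin.
  by exists (4 / 3 * q 0%N) => v; have := Gbound 0%N n v isT; rewrite subr0.
have [U UU ooU] := free_ultrafilter.
have Gcvg v : cvg (G n v @[n --> U]).
  apply: (@ultra_cvg R U UU (fun n => G n v) (4 / 3 * q 0%N * `|v|)) => n.
  by have := Gbound 0%N n v isT; rewrite subr0.
pose f v : R := lim (G n v @[n --> U]).
have fG m v : `|f v - G m v| <= 4 / 3 * q m * `|v|.
  apply: (@cvgr_to_le _ U _ R (fun n => `|G n v - G m v|)).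
    by apply: cvg_norm; apply: cvgB; [exact: Gcvg|exact: cvg_cst].
  by apply: ooU; exists m => // n /= mn; exact: Gbound.
have cf : cfun f.
  split=> [a x y|]; last first.
    by exists (4 / 3 * q 0%N) => v; have := fG 0%N v; rewrite subr0.
  rewrite /f; under eq_fun do rewrite Glin.
  apply: cvg_lim => //; apply: cvgD; last exact: Gcvg.
  by apply: cvgM; [exact: cvg_cst|exact: Gcvg].
have [M fM] := wcompact_cfun_bounded wC cf.
have [n Mn] : exists n : nat, M < n%:R.
  by exists (Num.truncn M).+1; exact: truncnS_gt.
have [Cu uP] := selP (n, G n) (cG n).
set u := sel (n, G n) in Cu uP; have /= := uP u Cu.
have [_ _ gu] := gP u.
have := fG n.+1 u; rewrite /= -/u gu.
have -> : q n.+1 = q n / 4 by rewrite /q exprSr.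
have qu : 0 <= q n * `|u| by rewrite mulr_ge0// ltW.
have := fM u Cu; rewrite !ler_norml => /andP[f1 f2] /andP[h1 h2].
have := ler_norm (- G n u); rewrite normrN; lra.
Qed.

Lemma wcompact_closed C : wcompact C -> closed C.
Proof.
move=> wC; apply/closed_normP => x Cx.
have /choice[u uP] : forall n : nat, exists k, C k /\ `|x - k| < n.+1%:R^-1.
  move=> n; have [|k Ck xk] := Cx n.+1%:R^-1; first by rewrite invr_gt0.
  by exists k.
have [U UU ooU] := free_ultrafilter.
have [y Cy uy] := wcompact_wcvg wC (fun n => (uP n).1) (U := U).
suff : `|y - x| <= 0 by rewrite normr_le0 subr_eq0 => /eqP <-.
apply: (wcvg_norm_le uy); apply/cvgrPdist_lt => e e0; apply: ooU.
have /cvgrPdist_lt/(_ _ e0) := @cvg_harmonic R.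
apply: filterS => n; rewrite !sub0r !normrN normr_id; apply: le_lt_trans.
by rewrite distrC; apply: le_trans (ltW (uP n).2) (ler_norm _).
Qed.

Lemma wcompact_closed_sub C K : wcompact C -> K `<=` C -> closed K -> convex K ->
  wcompact K.
Proof.
move=> wC KC cK convK F PF FK; have [_ _ _ FS] := PF.
have [x [Cx Fx]] := wC F PF (FS _ _ KC FK).
by exists x; split => //; exact: (weak_cluster_closed PF).
Qed.

(** * Fixed points of contractions and minimal invariant sets *)

Section FixedPoints.
Variables (C : set V) (T : V -> V).
Hypotheses (wC : wcompact C) (convC : convex C).
Hypothesis TC : forall x, C x -> C (T x).
Hypothesis Tne : forall x y, C x -> C y -> `|T x - T y| <= `|x - y|.

(** Weak compactness stands in for completeness: the Picard iterates have a weak limit in [C], and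
    weak lower semicontinuity turns their Cauchy estimate into [|w - v n| <= q ^+ n * B]. *)
Lemma contraction_fixed_point (e : R) z : 0 < e -> e <= 1 -> C z ->
  exists2 w, C w & w = (1 - e) *: T w + e *: z.
Proof.
move=> e0 e1 Cz; pose S v := (1 - e) *: T v + e *: z; pose q := 1 - e.
have q0 : 0 <= q by rewrite subr_ge0.
have CS v : C v -> C (S v).
  move=> Cv; rewrite /S; have -> : e = 1 - (1 - e) by lra.
  by rewrite subKr; apply: convC; [exact: TC|done|lra|lra].
have SS x y : C x -> C y -> `|S x - S y| <= q * `|x - y|.
  move=> Cx Cy; rewrite /S opprD addrACA subrr addr0 -scalerBr normrZ.
  by rewrite ger0_norm// ler_wpM2l// Tne.
pose v n := iter n S z.
have Cv n : C (v n) by elim: n => //= n /CS.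
pose B := `|z - S z| / e.
have B0 : 0 <= B by rewrite divr_ge0// ltW.
have vB j : `|v j - z| <= B.
  elim: j => [|j IH]; first by rewrite subrr normr0.
  rewrite /=; apply: le_trans (ler_distD (S z) _ _) _.
  apply: le_trans (lerD (SS _ _ (Cv j) Cz) (lexx _)) _.
  have -> : `|S z - z| = e * B by rewrite distrC /B mulrC divfK// gt_eqF.
  by have := ler_wpM2l q0 IH; rewrite /q; lra.
have vd n j : `|v (n + j)%N - v n| <= q ^+ n * B.
  elim: n => [|n IH]; first by rewrite expr0 mul1r.
  rewrite addSn /=; apply: le_trans (SS _ _ (Cv _) (Cv _)) _.
  by rewrite exprS -mulrA ler_wpM2l.
have [U UU ooU] := free_ultrafilter.
have [w Cw vw] := wcompact_wcvg wC Cv (U := U).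
have wv n : `|w - v n| <= q ^+ n * B.
  have nc : cvg (`|v m - v n| @[m --> U]).
    apply: (@ultra_cvg R U UU (fun m => `|v m - v n|) (B + B)) => m.
    rewrite normr_id; apply: le_trans (ler_distD z _ _) _.
    by rewrite lerD// distrC.
  apply: le_trans (wcvg_norm_le vw nc) _; apply: limr_le => //.
  by apply: ooU; exists n => // m /= nm; rewrite -(subnKC nm).
exists w => //; apply/eqP; rewrite -subr_eq0 -normr_le0 -/(S w).
have lim0 : q ^+ n * (B + B) @[n --> \oo] --> (0 : R).
  have -> : 0 = 0 * (B + B) by rewrite mul0r.
  apply: cvgM; last exact: cvg_cst.
  by apply: cvg_expr; rewrite ger0_norm// /q; lra.
apply: (cvgr_to_ge lim0); apply: nearW => n.
apply: le_trans (ler_distD (v n.+1) _ _) _; rewrite mulrDr lerD//.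
  apply: le_trans (wv n.+1) _; rewrite ler_wpM2r// exprS ler_piMl ?exprn_ge0//.
  by rewrite /q; lra.
rewrite distrC; apply: le_trans (SS _ _ Cw (Cv n)) _.
apply: le_trans (wv n); rewrite ler_piMl//.
by rewrite /q; lra.
Qed.

Definition closed_invariant K := [/\ K !=set0, closed K, convex K, K `<=` C &
  forall x, K x -> K (T x)].

(** Zorn for reverse inclusion. The members of a chain generate a filter; its weak cluster point
    lies in each of them, as they are closed and convex, so their intersection is nonempty. *)
Lemma minimal_closed_invariant : C !=set0 ->
  exists2 K, closed_invariant K & forall L, closed_invariant L -> L `<=` K -> L = K.
Proof.
move=> C0.
have iC : closed_invariant C by split => //; exact: wcompact_closed.
pose I := {K | closed_invariant K}.
pose Rel (K L : I) := `[< sval L `<=` sval K >].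
have [|||A totA|[K iK] Kmin] := @Zorn I Rel.
- by move=> K; apply/asboolP.
- by move=> K L M /asboolP KL /asboolP LM; apply/asboolP; exact: subset_trans LM KL.
- move=> [K iK] [L iL] /asboolP/= LK /asboolP/= KL; apply: eq_exist => /=.
  by apply/seteqP.
- have [->|/set0P[K0 AK0]] := eqVneq A set0; first by exists (exist _ C iC).
  pose B := \bigcap_(K in A) sval K.
  pose F : set_system V := [set E | exists2 K : I, A K & sval K `<=` E].
  have PF : proper_filter F.
    split.
    + by exists K0.
    + move=> [K AK K0']; have [[x Kx] _ _ _ _] := svalP K; exact: (K0' x).
    + move=> E E' [K AK KE] [K' AK' KE'].
      have [/asboolP s|/asboolP s] := totA _ _ AK AK'.
        by exists K' => // x Kx; split; [apply: KE; exact: s|exact: KE'].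
      by exists K => // x Kx; split; [exact: KE|apply: KE'; exact: s].
    + by move=> E E' EE' [K AK KE]; exists K => // x /KE/EE'.
  have [|x [Cx Fx]] := wC PF.
    by exists K0 => //; have [] := svalP K0.
  have iB : closed_invariant B.
    split.
    + exists x => K AK; have [_ cK convK _ _] := svalP K.
      by apply: (weak_cluster_closed PF cK convK _ Fx); exists K.
    + by apply: closed_bigI => K AK; have [] := svalP K.
    + move=> y z t By Bz t0 t1 K AK; have [_ _ convK _ _] := svalP K.
      by apply: convK => //; [exact: By|exact: Bz].
    + by move=> y By; have [_ _ _ KC _] := svalP K0; apply/KC/By.
    + by move=> y By K AK; have [_ _ _ _ KT] := svalP K; apply/KT/By.
  exists (exist _ B iB) => K AK; apply/asboolP => /= y; exact.
- exists K => // L iL LK.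
  by have := Kmin (exist _ L iL) => /(_ _)/(congr1 sval)/= -> //; exact/asboolP.
Qed.

End FixedPoints.

End WeaklyCompact.

(** * The Goebel-Karlovitz lemma *)

Section GoebelKarlovitz.
Variables (R : realType) (V : normedModType R) (C : set V) (T : V -> V).

Local Notation wcompact := (@weakly_compact R V +%R *:%R Num.norm).
Local Notation convex := (@Defs.convex_set R V +%R *:%R).

Hypotheses (wC : wcompact C) (convC : convex C).
Hypothesis TC : forall x, C x -> C (T x).
Hypothesis Tne : forall x y, C x -> C y -> `|T x - T y| <= `|x - y|.
Hypothesis Cmin : forall L, closed_invariant C T L -> L = C.

Lemma closed_near_ball (I : Type) (F : set_system I) {FF : Filter F} (u : I -> V) (s : R) :
  closed [set z | forall e : R, 0 < e -> \forall n \near F, `|u n - z| <= s + e].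
Proof.
apply/closed_normP => z zF e e0; have e20 : 0 < e / 2 by rewrite divr_gt0.
have [y yF zy] := zF _ e20; have := yF _ e20; apply: filterS => n uy.
by apply: le_trans (ler_distD y _ _) _; move: (distrC z y); lra.
Qed.

Lemma convex_comb_norm_le (u x y : V) (t s : R) : 0 <= t -> t <= 1 ->
  `|u - x| <= s -> `|u - y| <= s -> `|u - (t *: x + (1 - t) *: y)| <= s.
Proof.
move=> t0 t1 ux uy.
have -> : u - (t *: x + (1 - t) *: y) = t *: (u - x) + (1 - t) *: (u - y).
  rewrite !scalerBr addrACA -scalerDl -opprD.
  by rewrite [t + _]addrC subrK scale1r.
apply: le_trans (ler_normD _ _) _; rewrite !normrZ !ger0_norm ?subr_ge0//.
have := ler_wpM2l t0 ux; have : (1 - t) * `|u - y| <= (1 - t) * s.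
  by rewrite ler_wpM2l// subr_ge0.
lra.
Qed.

(** [L] encodes that the upper limit of [|u n - z|] is at most [s]. It is closed and convex, so
    invariance and minimality leave only [C]. *)
Lemma near_ball_invariant (u : nat -> V) (F : set_system nat) {FF : Filter F} (s : R)
 :
  let L := [set z | C z /\ forall e : R, 0 < e -> \forall n \near F, `|u n - z| <= s + e] in
  L !=set0 -> (forall z, L z -> L (T z)) -> forall z, C z -> L z.
Proof.
move=> L L0 TL z Cz; suff -> : L = C by [].
apply: Cmin; split => //.
- by apply: closedI; [exact: wcompact_closed | exact: closed_near_ball].
- move=> x y t [Cx xF] [Cy yF] t0 t1; split; first exact: convC.
  move=> e e0; apply: filterS (filterI (xF e e0) (yF e e0)) => n [/= ux uy].
  exact: convex_comb_norm_le.
- by move=> x [].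
Qed.

(** The centres [z] of balls of radius [s] that contain [C] form an invariant set: for such [z], the
    points of [C] within [s] of [T z] are again invariant, hence all of [C]. *)
Lemma minimal_diametral x (s : R) : C x -> (forall y, C y -> `|x - y| <= s) ->
  forall y z, C y -> C z -> `|y - z| <= s.
Proof.
move=> Cx xs.
pose L := [set z | C z /\ forall y, C y -> `|y - z| <= s].
suff LC : L = C by move=> y z Cy; rewrite -{1}LC => -[_]; exact.
apply: Cmin; split.
- by exists x; split => // y Cy; rewrite distrC xs.
- apply/closed_normP => z zL; split.
    move/closed_normP: (wcompact_closed wC); apply => e /zL[k [Ck _] zk].
    by exists k.
  move=> y Cy; apply/ler_addgt0Pr => e e0; have [k [Ck kL] zk] := zL e e0.
  by apply: le_trans (ler_distD k _ _) _; have := kL y Cy; move: (distrC z k); lra.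
- move=> y z t [Cy yL] [Cz zL] t0 t1; split; first exact: convC.
  by move=> v Cv; apply: convex_comb_norm_le; [| |exact: yL|exact: zL].
- by move=> z [].
- move=> z [Cz zL]; split; first exact: TC.
  pose M := [set y | C y /\ `|T z - y| <= s].
  suff MC : M = C by move=> y; rewrite -{1}MC distrC => -[].
  apply: Cmin; split.
  + by exists (T z); split; [exact: TC|rewrite subrr normr0 (le_trans _ (xs x Cx))].
  + apply/closed_normP => y yM; split.
      move/closed_normP: (wcompact_closed wC); apply => e /yM[k [Ck _] yk].
      by exists k.
    apply/ler_addgt0Pr => e e0; have [k [Ck kM] yk] := yM e e0.
    by apply: le_trans (ler_distD k _ _) _; move: (distrC y k); lra.
  + move=> y v t [Cy yM] [Cv vM] t0 t1; split; first exact: convC.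
    exact: convex_comb_norm_le.
  + by move=> y [].
  + move=> y [Cy _]; split; first exact: TC.
    by apply: le_trans (Tne Cz Cy) _; rewrite distrC zL.
Qed.

(** Otherwise an approximate fixed point sequence stays within [s] of [x], hence asymptotically
    within [s] of every point of [C]. So does its weak limit, and [minimal_diametral] bounds the
    diameter by [s < t]. *)
Lemma goebel_karlovitz x (s t : R) : C x -> s < t ->
  (forall s' : R, (forall y z, C y -> C z -> `|y - z| <= s') -> t <= s') ->
  exists2 e : R, 0 < e & forall y, C y -> `|y - T y| <= e -> s <= `|y - x|.
Proof.
move=> Cx st tdiam; apply: contrapT => H.
have /choice[u uP] : forall n : nat, exists y, [/\ C y, `|y - T y| <= n.+1%:R^-1
    & `|y - x| < s].
  move=> n; apply: contrapT => H'; apply: H; exists n.+1%:R^-1; first by rewrite invr_gt0.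
  move=> y Cy yT; rewrite leNgt; apply/negP => yx; apply: H'.
  by exists y.
have Lz z : C z -> forall e : R, 0 < e -> \forall n \near \oo, `|u n - z| <= s + e.
  move=> Cz; have [||_ //] := @near_ball_invariant u \oo _ s _ _ z Cz.
    exists x; split => // e e0; apply: nearW => n; have [_ _ ux] := uP n.
    by apply: ltW; apply: (lt_le_trans ux); rewrite lerDl ltW.
  move=> y [Cy yF]; split; first exact: TC.
  move=> e e0; have e20 : 0 < e / 2 by rewrite divr_gt0.
  have /cvgrPdist_lt/(_ _ e20) := @cvg_harmonic R.
  move=> hn; apply: filterS (filterI (yF _ e20) hn) => n [/= un].
  rewrite sub0r normrN /harmonic ger0_norm ?invr_ge0// => hn'.
  have [Cu uT _] := uP n; apply: le_trans (ler_distD (T (u n)) _ _) _.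
  apply: le_trans (lerD uT (le_trans (Tne Cu Cy) un)) _.
  by rewrite addrCA lerD2l [leRHS]splitr lerD2r ltW.
have [U UU ooU] := free_ultrafilter.
have [v Cv uv] := wcompact_wcvg wC (fun n => let: And3 Cu _ _ := uP n in Cu) (U := U).
suff : t <= s by rewrite leNgt st.
apply: tdiam; apply: (minimal_diametral Cv) => y Cy.
have cn : cvg (`|u n - y| @[n --> U]).
  apply: (@ultra_cvg R U UU (fun n => `|u n - y|) (s + `|x - y|)) => n.
  rewrite normr_id; have [_ _ ux] := uP n.
  by apply: le_trans (ler_distD x _ _) _; lra.
apply: le_trans (wcvg_norm_le uv cn) _; apply/ler_addgt0Pr => e e0.
by apply: limr_le => //; apply: ooU; exact: Lz.
Qed.

Lemma approximate_fixed_point (e : R) : C !=set0 -> 0 < e ->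
  exists2 y, C y & `|y - T y| <= e.
Proof.
move=> [z Cz] e0; have [M CM] := wcompact_bounded wC.
have M0 : 0 <= M by exact: le_trans (CM z Cz).
pose h := Num.min 1 (e / (1 + M + M)).
have D0 : 0 < 1 + M + M by lra.
have h0 : 0 < h by rewrite lt_min ltr01 divr_gt0.
have h1 : h <= 1 by rewrite ge_min lexx.
have [w Cw wE] := contraction_fixed_point wC convC TC Tne h0 h1 Cz.
exists w => //; have -> : w - T w = h *: (z - T w).
  by rewrite {1}wE scalerBl scale1r scalerBr addrAC [_ - _ - T w]addrAC subrr sub0r addrC.
rewrite normrZ gtr0_norm//.
have hE : h * (1 + M + M) <= e by rewrite -ler_pdivlMr// ge_min lexx orbT.
apply: le_trans hE; apply: ler_wpM2l; first exact: ltW.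
by apply: le_trans (ler_normB _ _) _; have := CM z Cz; have := CM _ (TC Cw); lra.
Qed.

End GoebelKarlovitz.

(** * The coefficient M(X) *)

Section RealEstimate.
Variables (R : realType) (X : normedModType R).

Lemma limn_esup_le_near (f : nat -> \bar R) (c : \bar R) :
  (\forall n \near \oo, (f n <= c)%E) -> (limn_esup f <= c)%E.
Proof.
move=> fc; apply: (@le_trans _ _ (ereal_sup (f @` [set n | (f n <= c)%E]))).
  by apply: ereal_inf_lbound; exists [set n | (f n <= c)%E].
by apply: ge_ereal_sup => _ [n fnc <-].
Qed.

Lemma limn_einf_ge_near (f : nat -> \bar R) (c : \bar R) :
  (\forall n \near \oo, (c <= f n)%E) -> (c <= limn_einf f)%E.
Proof.
move=> fc; rewrite /limn_einf leeNr; apply: limn_esup_le_near.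
by apply: filterS fc => n; rewrite leeN2.
Qed.

(** Some [a] has [R(a, X) < 1 + a], and [d] fits strictly into this gap. The bound on all pairs
    [l < k] controls the iterated upper limit in [Rcoef]. *)
Lemma Mcoef_gt1 : (1%:E < Mcoef X)%E ->
  exists a d : R, [/\ 0 <= a, 0 < d & forall (x : X) (u : nat -> X),
    `|x| <= a -> (forall n, `|u n| <= 1) -> wnull u ->
    (forall l k, (l < k)%N -> `|u l - u k| <= 1) ->
    ~ forall n, 1 + a - d <= `|u n + x|].
Proof.
move=> /ereal_sup_gt[_ [a /= a0 <-] gt1].
have a1 : 0 < 1 + a by rewrite ltr_pwDl.
have Ra : (Rcoef X a < (1 + a)%:E)%E.
  rewrite ltNge; apply/negP => aR; move: gt1; rewrite ltNge => /negP; apply.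
  move: aR; case: (Rcoef X a) => [r| |] //=.
    rewrite lee_fin => ar.
    have r0 : 0 < r by exact: lt_le_trans ar.
    by rewrite inver gt_eqF// lee_pdivrMr// mul1e lee_fin.
  by move=> _; rewrite invey mule0 lee_fin.
have [d d0 Rd] : exists2 d : R, 0 < d & (Rcoef X a < (1 + a - d)%:E)%E.
  move: Ra; case: (Rcoef X a) => [r| |] //=; last by exists 1 => //; exact: ltNyr.
  rewrite lte_fin => ra; exists ((1 + a - r) / 2); first by rewrite divr_gt0// subr_gt0.
  by rewrite lte_fin; lra.
exists a, d; split => // x u xa u1 u0 uD ux.
move: Rd; rewrite ltNge => /negP; apply.
apply: le_trans (limn_einf_ge_near (f := fun n => (`|u n + x|)%:E) _) _.
  by apply: nearW => n; rewrite lee_fin; exact: ux.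
apply: ereal_sup_ubound; exists x, u; split => //.
apply: limn_esup_le_near; apply: nearW => n; apply: limn_esup_le_near.
by exists n.+1 => // m /= nm; rewrite lee_fin uD.
Qed.

(* By convexity of [s |-> |y + s v|], nearly maximal growth of the norm from [y]
   to [y + v] persists at every other scale [s]. *)
Lemma norm_rescale (y v : X) (b c t s : R) : 0 <= t -> 0 <= s ->
  `|y| <= b + t -> `|v| <= c + t -> b + c - t <= `|y + v| ->
  b + s * c - 2 * (s + 1) * t <= `|y + s *: v|.
Proof.
move=> t0 s0 yb vc yv.
have [s1|/ltW s1] := leP s 1.
  have -> : y + s *: v = (y + v) - (1 - s) *: v.
    by rewrite scalerBl scale1r opprB [s *: v - v]addrC addrA addrK.
  have := lerB_normD (y + v) (- ((1 - s) *: v)).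
  rewrite normrN normrZ ger0_norm ?subr_ge0//.
  have : (1 - s) * `|v| <= (1 - s) * (c + t) by rewrite ler_wpM2l// subr_ge0.
  have := mulr_ge0 s0 t0; lra.
have : s * (b + c - t) <= `|s *: y + s *: v|.
  by rewrite -scalerDr normrZ ger0_norm// ler_wpM2l.
have -> : s *: y + s *: v = (y + s *: v) + (s - 1) *: y.
  by rewrite scalerBl scale1r [y + _]addrC -addrA [y + _]addrC subrK addrC.
have := ler_normD (y + s *: v) ((s - 1) *: y).
rewrite normrZ ger0_norm ?subr_ge0//.
have : (s - 1) * `|y| <= (s - 1) * (b + t) by rewrite ler_wpM2l// subr_ge0.
have := mulr_ge0 s0 t0; lra.
Qed.

(** Rescaling [y] by [1 / (b + t)] and [v] by [a / (c + t)] would produce a sequence forbidden by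
    [Mcoef_gt1], since [norm_rescale] carries near-additivity of the norm to these scales. *)
Lemma Mcoef_gt1_no_additive_sequence (b c : R) : (1%:E < Mcoef X)%E -> 0 < b -> 0 < c ->
  exists2 t : R, 0 < t & forall (y : nat -> X) (v : X),
    wnull y -> (forall n, `|y n| <= b + t) -> `|v| <= c + t ->
    (forall l k, (l < k)%N -> `|y l - y k| <= b + t) ->
    ~ forall n, b + c - t <= `|y n + v|.
Proof.
move=> /Mcoef_gt1[a [d [a0 d0 H]]] b0 c0.
have q0 : 0 < 3 * (b^-1 + a / c).
  by rewrite mulr_gt0// ltr_pwDl ?invr_gt0// divr_ge0// ltW.
(* After multiplication by [b + t] the total loss is [3 t + 3 t (b + t) a / (c + t)], at most [(b +
   t) * 3 t (1 / b + a / c) = (b + t) d]. *)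
pose t := d / (3 * (b^-1 + a / c)); have t0 : 0 < t by rewrite divr_gt0.
exists t => // y v y0 yb vc yD yv.
have bt0 : 0 < b + t by rewrite addr_gt0.
have ct0 : 0 < c + t by rewrite addr_gt0.
have ib0 : 0 <= (b + t)^-1 by rewrite invr_ge0 ltW.
have s0 : 0 <= a / (c + t) by rewrite divr_ge0// ltW.
have scaled (z : X) : `|z| <= b + t -> `|(b + t)^-1 *: z| <= 1.
  by move=> zb; rewrite normrZ ger0_norm// mulrC ler_pdivrMr// mul1r.
apply: (H ((a / (c + t)) *: v) (fun n => (b + t)^-1 *: y n)).
- rewrite normrZ ger0_norm// mulrAC ler_pdivrMr//.
  by rewrite ler_wpM2l.
- by move=> n; exact: scaled.
- move=> f cf; have fZ z : f ((b + t)^-1 *: z) = (b + t)^-1 * f z.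
    have [fl _] := cf; have f0 : f 0 = 0 by have := fl 1 0 0; rewrite scale1r addr0; lra.
    by have := fl (b + t)^-1 z 0; rewrite addr0 f0 addr0.
  under eq_fun do rewrite fZ.
  rewrite -[0](mulr0 (b + t)^-1); apply: cvgM; first exact: cvg_cst.
  exact: y0.
- by move=> l k lk; rewrite -scalerBr; apply/scaled/yD.
- move=> n.
  have := norm_rescale (ltW t0) (mulr_ge0 (ltW bt0) s0) (yb n) vc (yv n).
  set s := a / (c + t) => sn.
  have -> : (b + t)^-1 *: y n + s *: v = (b + t)^-1 *: (y n + ((b + t) * s) *: v).
    by rewrite scalerDr scalerA mulrA mulVf ?mul1r// gt_eqF.
  rewrite normrZ ger0_norm// mulrC ler_pdivlMr//; apply: le_trans sn.
  have tE : t * (3 * (b^-1 + a / c)) = d by rewrite /t divfK// gt_eqF.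
  have b1 : b * b^-1 = 1 by rewrite divff// gt_eqF.
  have sE : s * (c + t) = a by rewrite /s divfK// gt_eqF.
  have ac : s <= a / c by rewrite /s ler_wpM2l// lef_pV2 ?posrE// lerDl ltW.
  have step1 : 3 * t * s <= 3 * t * (a / c) by rewrite ler_wpM2l// mulr_ge0// ltW.
  have step2 : 3 * t <= (b + t) * (3 * t * b^-1).
    have : 0 <= t * (3 * t * b^-1) by rewrite !mulr_ge0 ?ltW// invr_gt0.
    have -> : (b + t) * (3 * t * b^-1) = 3 * t * (b * b^-1) + t * (3 * t * b^-1) by ring.
    by rewrite b1; lra.
  have : (b + t) * (3 * t * s) <= (b + t) * (3 * t * (a / c)) by rewrite ler_wpM2l// ltW.
  have -> : (1 + a - d) * (b + t) = (b + t) + (b + t) * (s * (c + t))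
     - (b + t) * (3 * t * b^-1) - (b + t) * (3 * t * (a / c)).
    by rewrite sE -tE; ring.
  lra.
Qed.

End RealEstimate.

(** * The psi-direct sum as a normed space *)

Section PsiNormTheory.
Variables (R : realType) (r : nat) (psi : 'rV[R]_r -> R).
Hypotheses (psiN : is_norm_Rr psi) (psiA : absolute_norm psi)
  (psi1 : normalized_norm psi) (psiM : strictly_monotone psi).
Implicit Types s t : 'I_r -> R.

Definition psif (t : 'I_r -> R) : R := psi (\row_i t i).

Lemma psif_ext s t : s =1 t -> psif s = psif t.
Proof. by move=> st; congr psi; apply/rowP => i; rewrite !mxE. Qed.

(** Strict monotonicity is silent when all moduli agree; there absoluteness gives equality. *)
Lemma psif_le s t : (forall i, `|s i| <= `|t i|) -> psif s <= psif t.
Proof.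
move=> st; have [[i sti]|nst] := pselect (exists i, `|s i| < `|t i|).
  by apply/ltW/psiM => [j|]; [|exists i]; rewrite !mxE.
rewrite le_eqVlt; apply/orP; left; apply/eqP.
rewrite /psif psiA [RHS]psiA; congr psi; apply/rowP => i; rewrite !mxE.
apply/eqP; rewrite eq_le st/= leNgt; apply/negP => sti.
by apply: nst; exists i.
Qed.

(** Contrapositive of strict monotonicity, used to turn an equality of norms into equalities in
    every coordinate. *)
Lemma psif_le_eq s t : (forall i, 0 <= s i <= t i) -> psif t <= psif s -> s =1 t.
Proof.
move=> st ts i; have [s0 sti] := andP (st i).
apply/eqP; rewrite eq_le sti/= leNgt; apply/negP => lt.
move: ts; rewrite leNgt => /negP; apply; apply: psiM => [j|].
  by have /andP[sj stj] := st j; rewrite !mxE !ger0_norm// (le_trans sj).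
by exists i; rewrite !mxE !ger0_norm// (le_trans s0).
Qed.

Lemma psifD s t : psif (fun i => s i + t i) <= psif s + psif t.
Proof.
have [_ _ tri] := psiN; apply: le_trans (tri _ _); rewrite le_eqVlt; apply/orP; left.
by apply/eqP; congr psi; apply/rowP => i; rewrite !mxE.
Qed.

Lemma psifZ (a : R) t : psif (fun i => a * t i) = `|a| * psif t.
Proof.
by have [_ <- _] := psiN; congr psi; apply/rowP => i; rewrite !mxE.
Qed.

Lemma le_psif t i : `|t i| <= psif t.
Proof.
have <- : psif (fun j => t i * (j == i)%:R) = `|t i|.
  rewrite psifZ; transitivity (`|t i| * psi (delta_mx 0 i)); last by rewrite psi1 mulr1.
  by congr (_ * psi _); apply/rowP => j; rewrite !mxE eqxx.
apply: psif_le => j; rewrite normrM; case: eqP => [->|_].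
  by rewrite normr1 mulr1.
by rewrite normr0 mulr0.
Qed.

Lemma psif_le_sum t : psif t <= \sum_i `|t i|.
Proof.
have [_ sc tri] := psiN.
have -> : psif t = psi (\sum_i t i *: delta_mx 0 i).
  by congr psi; rewrite [LHS]row_sum_delta; apply: eq_bigr => i _; rewrite mxE.
have psi0 : psi 0 = 0 by rewrite -(scale0r 0) sc normr0 mul0r.
elim/big_rec2: _ => [|i y1 y2 _ IH]; first by rewrite psi0.
by apply: le_trans (tri _ _) _; rewrite sc psi1 mulr1 lerD2l.
Qed.

(** The norm is 1-Lipschitz for the sum of the moduli, hence continuous. *)
Lemma psif_cvg (I : Type) (F : set_system I) {FF : Filter F} (f : I -> 'I_r -> R) t :
  (forall i, f n i @[n --> F] --> t i) -> psif (f n) @[n --> F] --> psif t.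
Proof.
move=> ft; apply/cvgrPdist_lt => e e0.
have lip u v : psif u - psif v <= \sum_i `|u i - v i|.
  apply: le_trans (psif_le_sum _); have := psifD v (fun i => u i - v i).
  rewrite (@psif_ext _ u) => [|i]; last by rewrite addrC subrK.
  by lra.
have : \sum_i `|t i - f n i| @[n --> F] --> \sum_(i < r) `|t i - t i|.
  apply: cvg_big => [|i _]; first exact: add_continuous.
  apply: cvg_norm; apply: cvgB; [exact: cvg_cst|exact: ft].
rewrite big1 => [|i _]; last by rewrite subrr normr0.
move=> /cvgrPdist_lt/(_ _ e0); apply: filterS => n.
rewrite sub0r normrN ger0_norm ?sumr_ge0// => lt; apply: le_lt_trans lt.
rewrite ler_norml lip andbT lerNl opprB; apply: le_trans (lip _ _) _.
by apply: ler_sum => i _; rewrite distrC.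
Qed.

End PsiNormTheory.

Section PsumNormed.
Variables (R : realType) (r : nat) (X : 'I_r -> normedModType R)
  (psi : 'rV[R]_r -> R).

(* The unused hypotheses in the type let its norm be inferred from the type alone. *)
Definition psum_normed (psiN : is_norm_Rr psi) (psiA : absolute_norm psi)
  (psiM : strictly_monotone psi) : Type := psum X.

Variables (psiN : is_norm_Rr psi) (psiA : absolute_norm psi)
  (psiM : strictly_monotone psi).
Local Notation V := (psum_normed psiN psiA psiM).

HB.instance Definition _ := gen_eqMixin V.
HB.instance Definition _ := gen_choiceMixin V.

Let add : V -> V -> V := @psum_add R r X.
Let opp : V -> V := fun x i => - x i.
Let zero : V := fun i => 0.
Let scale : R -> V -> V := @psum_scale R r X.

Let addA : associative add.
Proof. by move=> x y z; apply: functional_extensionality_dep => i; exact: addrA. Qed.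

Let addC : commutative add.
Proof. by move=> x y; apply: functional_extensionality_dep => i; exact: addrC. Qed.

Let add0 : left_id zero add.
Proof. by move=> x; apply: functional_extensionality_dep => i; exact: add0r. Qed.

Let addN : left_inverse zero opp add.
Proof. by move=> x; apply: functional_extensionality_dep => i; exact: addNr. Qed.

HB.instance Definition _ := GRing.isZmodule.Build V addA addC add0 addN.

Let scaleA a b x : scale a (scale b x) = scale (a * b) x.
Proof. by apply: functional_extensionality_dep => i; exact: scalerA. Qed.

Let scale1 : left_id 1 scale.
Proof. by move=> x; apply: functional_extensionality_dep => i; exact: scale1r. Qed.

Let scaleDr : right_distributive scale +%R.
Proof. by move=> a x y; apply: functional_extensionality_dep => i; exact: scalerDr. Qed.

Let scaleDl x : {morph scale^~ x : a b / a + b}.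
Proof. by move=> a b; apply: functional_extensionality_dep => i; exact: scalerDl. Qed.

HB.instance Definition _ :=
  GRing.Zmodule_isLmodule.Build R V scaleA scale1 scaleDr scaleDl.

Let nrm : V -> R := @psum_norm R r X psi.

Let nrmD (x y : V) : nrm (x + y) <= nrm x + nrm y.
Proof.
apply: le_trans (psifD psiN _ _); apply: psif_le => // i.
by rewrite normr_id ger0_norm ?addr_ge0// ler_normD.
Qed.

Let nrmZ (a : R) (x : V) : nrm (a *: x) = `|a| * nrm x.
Proof.
rewrite -[X in X * _]normr_id -(psifZ psiN); apply: psif_ext => i.
exact: normrZ.
Qed.

Let nrm0 (x : V) : nrm x = 0 -> x = 0.
Proof.
have [psi0 _ _] := psiN; move=> /psi0/rowP x0.
apply: functional_extensionality_dep => i; apply/eqP.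
by have := x0 i; rewrite !mxE => /eqP; rewrite normr_eq0.
Qed.

HB.instance Definition _ := Lmodule_isNormed.Build R V nrmD nrmZ nrm0.

(** The normed structure unfolds to the componentwise operations and [psum_norm], so the two
    properties are convertible. *)
Lemma psum_WFPP_normed :
  @WFPP R V +%R *:%R Num.norm -> psum_WFPP X psi.
Proof. exact. Qed.

End PsumNormed.

(** * Fixed points in the direct sum *)

Section PsumFixedPoint.
Variables (R : realType) (r : nat) (X : 'I_r -> normedModType R)
  (psi : 'rV[R]_r -> R).
Hypotheses (psiN : is_norm_Rr psi) (psiA : absolute_norm psi)
  (psi1 : normalized_norm psi) (psiM : strictly_monotone psi).

Local Notation V := (psum_normed X psiN psiA psiM).
Local Notation psif := (psif psi).

Definition psum_coord (i : 'I_r) (x : V) : X i := x i.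

Lemma psum_coordB i (x y : V) : psum_coord i (x - y) = psum_coord i x - psum_coord i y.
Proof. by []. Qed.

Lemma psum_coord_le i (x : V) : `|psum_coord i x| <= `|x|.
Proof.
have := le_psif psiN psiA psi1 psiM (fun i => `|psum_coord i x|) i.
by rewrite normr_id.
Qed.

Lemma wcvg_psum_coord (F : set_system nat) (u : nat -> V) (x : V) i :
  wcvg F u x -> wcvg F (fun n => psum_coord i (u n)) (psum_coord i x).
Proof.
move=> ux f [fl [M fM]]; apply: (ux (fun y => f (psum_coord i y))); split.
  by move=> a y z; rewrite -fl.
exists `|M| => y; apply: le_trans (fM _) _.
by apply: le_trans (ler_wpM2r _ (ler_norm M)) _ => //; rewrite ler_wpM2l// psum_coord_le.
Qed.

Arguments wcvg_psum_coord {F u x} i.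

(** The subsequence is extracted in the sum, where weak compactness is given, and then projected to
    coordinate [i]. The tolerance [t] is fixed before the sequence, so it can be met by going far
    enough along the limits. *)
Lemma no_additive_component (i : 'I_r) (b c : R) :
  (1%:E < Mcoef (X i))%E -> 0 < b -> 0 < c ->
  exists2 t : R, 0 < t &
  forall (U : set_system nat) (UU : UltraFilter U) (C : set V) (w : nat -> V) (y z : V),
  @weakly_compact R V +%R *:%R Num.norm C -> (forall n, C (w n)) -> wcvg U w y ->
  (\forall n \near U, `|psum_coord i (w n) - psum_coord i y| < b + t) ->
  (\forall n \near U, \forall m \near U, `|psum_coord i (w n) - psum_coord i (w m)| < b + t) ->
  `|psum_coord i y - psum_coord i z| < c + t ->
  ~ (\forall n \near U, b + c - t < `|psum_coord i (w n) - psum_coord i z|).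
Proof.
move=> Mi b0 c0; have [t t0 H] := Mcoef_gt1_no_additive_sequence Mi b0 c0.
exists t => // U UU C w y z wC Cw wy nb nD yz nA.
have [phi [phiA phiD phiw]] := weak_extraction wC Cw wy
  (filterI (filterI nb nD) nA) (fun n (An : _) => (proj2 (proj1 An))).
apply: (H (fun k => psum_coord i (w (phi k)) - psum_coord i y) (psum_coord i y - psum_coord i z)).
- move=> f cf; have /= fw := wcvg_psum_coord i phiw f cf.
  under eq_fun do rewrite cfunB//.
  rewrite -[0](subrr (f (psum_coord i y))); apply: cvgB; [exact: fw|exact: cvg_cst].
- by move=> k; have [[/ltW]] := phiA k.
- exact: ltW.
- by move=> l k lk; rewrite opprB addrA subrK ltW// phiD.
- by move=> k; rewrite addrA subrK; have [_ /ltW] := phiA k.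
Qed.

Lemma exists_avoiding (s : seq R) (d : R) : 0 < d ->
  exists2 t : R, 0 < t < d & t \notin s.
Proof.
(* The induction needs a whole interval above 0 that misses [s]; its midpoint is then a witness. *)
move=> d0; suff [t /andP[t0 td] ts] : exists2 t : R, 0 < t <= d &
    forall t', 0 < t' < t -> t' \notin s.
  exists (t / 2); first by rewrite divr_gt0//=; lra.
  by apply: ts; rewrite divr_gt0//=; lra.
elim: s => [|x s [t /andP[t0 td] ts]]; first by exists d; rewrite ?d0 ?lexx.
have [x0|x0] := ltP 0 x.
  exists (Num.min t x); first by rewrite lt_min t0 x0 ge_min td.
  move=> t' /andP[t'0]; rewrite lt_min => /andP[t't t'x].
  by rewrite inE negb_or lt_eqF//= ts// t'0.
exists t; first by rewrite t0.
move=> t' t't; rewrite inE negb_or ts// andbT gt_eqF//.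
by case/andP: t't => t'0 _; exact: le_lt_trans t'0.
Qed.

Lemma convex_comb_dist (W : normedModType R) (e : R) (p p' z z' : W) : 0 <= e -> e <= 1 ->
  `|((1 - e) *: p + e *: z) - ((1 - e) *: p' + e *: z')| <=
  (1 - e) * `|p - p'| + e * `|z - z'|.
Proof.
move=> e0 e1; rewrite opprD addrACA -!scalerBr.
apply: le_trans (ler_normD _ _) _.
by rewrite !normrZ !ger0_norm ?subr_ge0.
Qed.

Lemma convex_comb_id (W : normedModType R) (e : R) (x : W) :
  x = (1 - e) *: x + e *: x.
Proof. by rewrite -scalerDl subrK scale1r. Qed.

(** * The diameter of a minimal invariant set *)

Section Minimal.
Hypothesis XM : forall i, (1%:E < Mcoef (X i))%E.
Variables (C : set V) (T : V -> V).
Hypotheses (C0 : C !=set0) (wC : @weakly_compact R V +%R *:%R Num.norm C)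
  (convC : @Defs.convex_set R V +%R *:%R C).
Hypothesis TC : forall x, C x -> C (T x).
Hypothesis Tne : forall x y, C x -> C y -> `|T x - T y| <= `|x - y|.
Hypothesis Cmin : forall L, closed_invariant C T L -> L = C.

Lemma minimal_diam0 (rho : R) : (forall x y, C x -> C y -> `|x - y| <= rho) ->
  (forall s : R, (forall x y, C x -> C y -> `|x - y| <= s) -> rho <= s) ->
  rho <= 0.
Proof.
move=> Crho diamC; rewrite leNgt; apply/negP => rho0.
have [U UU ooU] := free_ultrafilter.
pose ulim (f : nat -> R) : R := lim (f n @[n --> U]).
have ucvg (f : nat -> R) : (forall n, 0 <= f n <= rho) -> f n @[n --> U] --> ulim f.
  move=> fb; apply: (@ultra_cvg R U UU f rho) => n.
  by have /andP[f0 f1] := fb n; rewrite ger0_norm.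
have ulim_bound (f : nat -> R) : (forall n, 0 <= f n <= rho) -> 0 <= ulim f <= rho.
  move=> fb; apply/andP; split.
    by apply: (cvgr_to_ge (ucvg f fb)); apply: nearW => n; have /andP[] := fb n.
  by apply: (cvgr_to_le (ucvg f fb)); apply: nearW => n; have /andP[] := fb n.
have Ccomp i x y : C x -> C y -> 0 <= `|psum_coord i x - psum_coord i y| <= rho.
  move=> Cx Cy; rewrite normr_ge0 -psum_coordB.
  exact: le_trans (psum_coord_le i _) (Crho _ _ Cx Cy).
have /choice[xs xsP] : forall n : nat, exists y, C y /\ `|y - T y| <= n.+1%:R^-1.
  move=> n; have [|y Cy yT] := approximate_fixed_point wC convC TC Tne C0 (e := n.+1%:R^-1).
    by rewrite invr_gt0.
  by exists y.
have Cxs n := (xsP n).1.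
have [xo Cxo xsxo] := wcompact_wcvg wC Cxs (U := U).
pose d i := ulim (fun n => `|psum_coord i (xs n) - psum_coord i xo|).
have dc i : `|psum_coord i (xs n) - psum_coord i xo| @[n --> U] --> d i.
  by apply: ucvg => n; exact: Ccomp.
pose dS (S : {set 'I_r}) := psif (fun i => if i \in S then d i else 0).
have [tau /andP[tau0 taur] tauS] := exists_avoiding (map dS (enum {set 'I_r})) rho0.
pose lam := tau / rho.
have lam0 : 0 <= lam by rewrite divr_ge0// ltW.
have lam1 : lam <= 1 by rewrite ler_pdivrMr// mul1r ltW.
have lamrho : lam * rho = tau by rewrite /lam divfK// gt_eqF.
(* The weight [lam] puts the [zs n] within [tau] of each other and within [rho - tau] of [xs n]. *)
pose zs n : V := (1 - lam) *: xo + lam *: xs n.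
have Czs n : C (zs n).
  rewrite /zs; have -> : lam *: xs n = (1 - (1 - lam)) *: xs n by congr (_ *: _); lra.
  by apply: convC => //; lra.
pose e (k : nat) : R := k.+1%:R^-1.
have e0 k : 0 < e k by rewrite invr_gt0.
have e1 k : e k <= 1 by rewrite invf_le1 ?ler1n.
have /choice[w' wP] : forall p : nat * nat, exists v, C v /\
    v = (1 - e p.1) *: T v + e p.1 *: zs p.2.
  move=> [k n]; have [v Cv vE] := contraction_fixed_point wC convC TC Tne (e0 k) (e1 k) (Czs n).
  by exists v.
pose w k n := w' (k, n).
have Cw k n : C (w k n) := (wP (k, n)).1.
have wE k n : w k n = (1 - e k) *: T (w k n) + e k *: zs n := (wP (k, n)).2.
(* By nonexpansiveness the distance [s] satisfies [s <= (1 - e k) s + e k tau]; cancelling leaves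
   [s <= tau]. *)
have w_diam k n m : `|w k n - w k m| <= tau.
  have zz : `|zs n - zs m| <= tau.
    apply: le_trans (convex_comb_dist _ _ _ _ lam0 lam1) _.
    rewrite subrr normr0 mulr0 add0r -lamrho.
    by rewrite ler_wpM2l// Crho.
  have := convex_comb_dist (T (w k n)) (T (w k m)) (zs n) (zs m) (ltW (e0 k)) (e1 k).
  rewrite -!wE.
  have : (1 - e k) * `|T (w k n) - T (w k m)| <= (1 - e k) * `|w k n - w k m|.
    by rewrite ler_wpM2l ?subr_ge0// Tne.
  have : e k * `|zs n - zs m| <= e k * tau by rewrite ler_wpM2l// ltW.
  move=> H1 H2 H3; rewrite -(ler_pM2l (e0 k)); lra.
(* The same cancellation, with the displacement of [xs n] divided by [e k] as error. It vanishes as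
   [n] grows with [k] fixed, so limits in [n] come first. *)
have w_near k n : `|w k n - xs n| <= rho - tau + `|xs n - T (xs n)| / e k.
  have zx : `|zs n - xs n| <= rho - tau.
    rewrite [X in _ - X](convex_comb_id lam).
    apply: le_trans (convex_comb_dist _ _ _ _ lam0 lam1) _.
    rewrite subrr normr0 mulr0 addr0 -lamrho -[X in _ <= X - _]mul1r -mulrBl.
    by rewrite ler_wpM2l ?subr_ge0// Crho.
  have := convex_comb_dist (T (w k n)) (xs n) (zs n) (xs n) (ltW (e0 k)) (e1 k).
  rewrite -wE -convex_comb_id.
  have Twx : `|T (w k n) - xs n| <= `|w k n - xs n| + `|xs n - T (xs n)|.
    apply: le_trans (ler_distD (T (xs n)) _ _) _.
    by rewrite [X in _ + X]distrC lerD// Tne.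
  have : (1 - e k) * `|T (w k n) - xs n| <=
      (1 - e k) * (`|w k n - xs n| + `|xs n - T (xs n)|).
    by rewrite ler_wpM2l ?subr_ge0.
  have : e k * `|zs n - xs n| <= e k * (rho - tau) by rewrite ler_wpM2l// ltW.
  have : 0 <= e k * `|xs n - T (xs n)| by rewrite mulr_ge0// ltW.
  have : e k * (`|xs n - T (xs n)| / e k) = `|xs n - T (xs n)|.
    by rewrite mulrC divfK// gt_eqF.
  move=> H1 H2 H3 H4 H5; rewrite -(ler_pM2l (e0 k)); lra.
(* The defining equation bounds the displacement of [w k n] under [T] by [e k * rho], uniformly in
   [n]. *)
have w_far s : s < rho -> \forall k \near \oo, forall n, s <= `|w k n - xo|.
  move=> srho.
  have [h h0 hP] := goebel_karlovitz wC convC TC Tne Cmin Cxo srho diamC.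
  have /cvgrPdist_lt/(_ (h / rho)) := @cvg_harmonic R.
  move=> /(_ _)/wrap[]; first by rewrite divr_gt0.
  apply: filterS => k; rewrite sub0r normrN /harmonic ger0_norm ?invr_ge0// => ek n.
  apply: hP => //; rewrite {1}wE [X in _ - X](convex_comb_id (e k)).
  apply: le_trans (convex_comb_dist _ _ _ _ (ltW (e0 k)) (e1 k)) _.
  rewrite subrr normr0 mulr0 add0r.
  apply: (@le_trans _ _ (e k * rho)); last by rewrite -ler_pdivlMr// ltW.
  by rewrite ler_wpM2l ?Crho// ?ltW//; exact: TC.
have /choice[wl wlP] : forall k, exists y, C y /\ wcvg U (w k) y.
  by move=> k; have [y Cy wy] := wcompact_wcvg wC (Cw k) (U := U); exists y.
have Cwl k := (wlP k).1; have wwl k := (wlP k).2.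
(* [A], [B], [Q], [D], [G]: coordinate norms of [w_n - xo], [w_n - w], [w - xo],
   [w_n - w_m], [w_n - x_n], with [w = wl k] and iterated limits in [n] and [m] *)
pose A k i := ulim (fun n => `|psum_coord i (w k n) - psum_coord i xo|).
pose B k i := ulim (fun n => `|psum_coord i (w k n) - psum_coord i (wl k)|).
pose Q k i := `|psum_coord i (wl k) - psum_coord i xo|.
pose D1 k i n := ulim (fun m => `|psum_coord i (w k n) - psum_coord i (w k m)|).
pose D k i := ulim (D1 k i).
pose G k i := ulim (fun n => `|psum_coord i (w k n) - psum_coord i (xs n)|).
have D1b k i n : 0 <= D1 k i n <= rho by apply: ulim_bound => m; exact: Ccomp.
have Ab k i : 0 <= A k i <= rho by apply: ulim_bound => n; exact: Ccomp.
have Bb k i : 0 <= B k i <= rho by apply: ulim_bound => n; exact: Ccomp.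
have Qb k i : 0 <= Q k i <= rho by exact: Ccomp.
have Db k i : 0 <= D k i <= rho by exact: ulim_bound.
have Gb k i : 0 <= G k i <= rho by apply: ulim_bound => n; exact: Ccomp.
have Ac k i : `|psum_coord i (w k n) - psum_coord i xo| @[n --> U] --> A k i.
  by apply: ucvg => n; exact: Ccomp.
have Bc k i : `|psum_coord i (w k n) - psum_coord i (wl k)| @[n --> U] --> B k i.
  by apply: ucvg => n; exact: Ccomp.
have D1c k i n : `|psum_coord i (w k n) - psum_coord i (w k m)| @[m --> U] --> D1 k i n.
  by apply: ucvg => m; exact: Ccomp.
have Dc k i : D1 k i n @[n --> U] --> D k i by exact: ucvg.
have Gc k i : `|psum_coord i (w k n) - psum_coord i (xs n)| @[n --> U] --> G k i.
  by apply: ucvg => n; exact: Ccomp.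
have A_le k i : A k i <= B k i + Q k i.
  apply: (le_cvg_lim (Ac k i) (cvgD (Bc k i) (cvg_cst (Q k i)))) => n /=.
  exact: ler_distD.
(* Weak lower semicontinuity as [w k m] tends to [wl k], for each fixed [n]; [Q_le] uses it for
   [w k n - xs n], whose weak limit is [wl k - xo]. *)
have B_le k i : B k i <= D k i.
  apply: (le_cvg_lim (Bc k i) (Dc k i)) => n.
  rewrite distrC; apply: (wcvg_norm_le (wcvg_psum_coord i (wwl k))).
  by under eq_fun do rewrite distrC; exact: D1c.
have Q_le k i : Q k i <= G k i.
  rewrite /Q -[X in `|X|]subr0.
  apply: (wcvg_norm_le (wcvg_sub (wcvg_psum_coord i (wwl k)) (wcvg_psum_coord i xsxo))).
  by under eq_fun do rewrite subr0; exact: Gc.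
have pcvg (f : nat -> 'I_r -> R) (t : 'I_r -> R) :
    (forall i, f n i @[n --> U] --> t i) -> psif (f n) @[n --> U] --> psif t.
  exact: psif_cvg.
have A_ge s : s < rho -> \forall k \near \oo, s <= psif (A k).
  move=> /w_far; apply: filterS => k wk.
  apply: (cvgr_to_ge (pcvg _ _ (Ac k))).
  by apply: nearW => n; exact: wk.
have D_le k : psif (D k) <= tau.
  apply: (cvgr_to_le (pcvg _ _ (Dc k))); apply: nearW => n.
  apply: (cvgr_to_le (pcvg _ _ (fun i => D1c k i n))).
  by apply: nearW => m; exact: w_diam.
have G_le k : psif (G k) <= rho - tau.
  have xT : `|xs n - T (xs n)| @[n --> U] --> (0 : R).
    apply/cvgrPdist_lt => h h0; apply: ooU.
    have /cvgrPdist_lt/(_ _ h0) := @cvg_harmonic R; apply: filterS => n.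
    rewrite !sub0r !normrN normr_id; apply: le_lt_trans.
    exact: le_trans (xsP n).2 (ler_norm _).
  have lim : rho - tau + `|xs n - T (xs n)| / e k @[n --> U] --> rho - tau.
    rewrite -[X in _ --> X]addr0 -[X in _ --> _ + X](mul0r (e k)^-1).
    by apply: cvgD; [exact: cvg_cst|apply: cvgM; [exact: xT|exact: cvg_cst]].
  exact: (le_cvg_lim (pcvg _ _ (Gc k)) lim (w_near k)).
(* With [d_ge]: [d i] and [B k i] differ by at most [G k i + Q k i], a bound that will vanish in the
   limit where [lQ i = 0]. *)
have d_le k i : d i <= B k i + (G k i + Q k i).
  apply: (le_cvg_lim (dc i) (cvgD (Bc k i) (cvgD (Gc k i) (cvg_cst (Q k i))))) => n /=.
  rewrite addrA; apply: le_trans (ler_distD (psum_coord i (wl k)) _ _) _; rewrite lerD2r.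
  by apply: le_trans (ler_distD (psum_coord i (w k n)) _ _) _; rewrite [leLHS]addrC lerD2l distrC.
have d_ge k i : B k i <= d i + (G k i + Q k i).
  apply: (le_cvg_lim (Bc k i) (cvgD (dc i) (cvgD (Gc k i) (cvg_cst (Q k i))))) => n /=.
  rewrite addrA; apply: le_trans (ler_distD (psum_coord i xo) _ _) _.
  rewrite [X in _ + X]distrC lerD2r.
  by apply: le_trans (ler_distD (psum_coord i (xs n)) _ _) _; rewrite [leLHS]addrC.
pose lA i := ulim (A^~ i); pose lB i := ulim (B^~ i); pose lQ i := ulim (Q^~ i).
pose lD i := ulim (D^~ i); pose lG i := ulim (G^~ i).
have lAc i : A k i @[k --> U] --> lA i by exact: ucvg.
have lBc i : B k i @[k --> U] --> lB i by exact: ucvg.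
have lQc i : Q k i @[k --> U] --> lQ i by exact: ucvg.
have lDc i : D k i @[k --> U] --> lD i by exact: ucvg.
have lGc i : G k i @[k --> U] --> lG i by exact: ucvg.
have lA0 i : 0 <= lA i by have /andP[] := ulim_bound (A^~ i) (Ab^~ i).
have lB0 i : 0 <= lB i by have /andP[] := ulim_bound (B^~ i) (Bb^~ i).
have lQ0 i : 0 <= lQ i by have /andP[] := ulim_bound (Q^~ i) (Qb^~ i).
have lAle i : lA i <= lB i + lQ i.
  exact: (le_cvg_lim (lAc i) (cvgD (lBc i) (lQc i)) (A_le^~ i)).
have lBle i : lB i <= lD i by exact: (le_cvg_lim (lBc i) (lDc i) (B_le^~ i)).
have lQle i : lQ i <= lG i by exact: (le_cvg_lim (lQc i) (lGc i) (Q_le^~ i)).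
have lAge : rho <= psif lA.
  apply/ler_addgt0Pr => h h0; rewrite -lerBlDr.
  apply: (cvgr_to_ge (pcvg _ _ lAc)).
  by apply: ooU; apply: A_ge; rewrite ltrBlDr ltrDl.
have lDle : psif lD <= tau.
  by apply: (cvgr_to_le (pcvg _ _ lDc)); exact: nearW.
have lGle : psif lG <= rho - tau.
  by apply: (cvgr_to_le (pcvg _ _ lGc)); exact: nearW.
have psif_mono (s t : 'I_r -> R) : (forall i, 0 <= s i <= t i) -> psif s <= psif t.
  move=> st; apply: (psif_le psiA psiM) => i; have /andP[s0 sti] := st i.
  by rewrite !ger0_norm// (le_trans s0).
have sumQ : psif lA <= psif (fun i => lB i + lQ i).
  by apply: psif_mono => i; rewrite lA0 lAle.
have sumle := psifD psiN lB lQ.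
have BD : psif lB <= psif lD by apply: psif_mono => i; rewrite lB0 lBle.
have QG : psif lQ <= psif lG by apply: psif_mono => i; rewrite lQ0 lQle.
(* The chain [rho <= psif lA <= psif (lB + lQ) <= psif lB + psif lQ <= psif lD + psif lG <= tau +
   (rho - tau)] consists of equalities. *)
have lBE : lB =1 lD.
  by apply: (psif_le_eq psiM) => [i|]; [rewrite lB0 lBle|lra].
have lQE : lQ =1 lG.
  by apply: (psif_le_eq psiM) => [i|]; [rewrite lQ0 lQle|lra].
have lAE : lA =1 (fun i => lB i + lQ i).
  by apply: (psif_le_eq psiM) => [i|]; [rewrite lA0 lAle|lra].
have lBtau : psif lB = tau by lra.
have lBd i : lB i = if lQ i == 0 then d i else 0.
  case: eqP => [Q0|/eqP Qn0].
    have G0 : lG i = 0 by rewrite -lQE.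
    have dB : d i <= lB i + (lG i + lQ i).
      exact: (le_cvg_lim (cvg_cst (d i)) (cvgD (lBc i) (cvgD (lGc i) (lQc i))) (d_le^~ i)).
    have Bd : lB i <= d i + (lG i + lQ i).
      exact: (le_cvg_lim (lBc i) (cvgD (cvg_cst (d i)) (cvgD (lGc i) (lQc i))) (d_ge^~ i)).
    by apply/eqP; rewrite eq_le; move: dB Bd; rewrite G0 Q0 !addr0 => -> ->.
  apply: contrapT => /eqP Bn0.
  have Q0 : 0 < lQ i by rewrite lt_neqAle eq_sym Qn0 lQ0.
  have B0 : 0 < lB i by rewrite lt_neqAle eq_sym Bn0 lB0.
  have [t t0 H] := no_additive_component (XM i) B0 Q0.
  have nA : \forall k \near U, lB i + lQ i - t < A k i.
    by apply: (cvgr_gt _ (lAc i)); rewrite lAE ltrBlDr ltrDl.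
  have nB : \forall k \near U, B k i < lB i + t.
    by apply: (cvgr_lt _ (lBc i)); rewrite ltrDl.
  have nQ : \forall k \near U, Q k i < lQ i + t.
    by apply: (cvgr_lt _ (lQc i)); rewrite ltrDl.
  have nD : \forall k \near U, D k i < lB i + t.
    by apply: (cvgr_lt _ (lDc i)); rewrite -lBE ltrDl.
  (* A single [k] meeting all four strict bounds suffices: the quantities converging in [n] then
     meet them eventually along [U]. *)
  have [k [[/= Ak Bk] [/= Qk Dk]]] := filter_ex (filterI (filterI nA nB) (filterI nQ nD)).
  apply: (H U UU C (w k) (wl k) xo wC (Cw k) (wwl k)) => //.
  - exact: (cvgr_lt _ (Bc k i)).
  - by apply: filterS (cvgr_lt _ (Dc k i) _ Dk) => n; exact: (cvgr_lt _ (D1c k i n)).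
  - exact: (cvgr_gt _ (Ac k i)).
move/negP: tauS; apply; apply/mapP; exists [set i | lQ i == 0]%SET.
  by rewrite mem_enum.
by rewrite -lBtau; apply: psif_ext => i; rewrite lBd inE.
Qed.

End Minimal.

(** A minimal invariant set has diameter 0, so each of its points is fixed. *)
Lemma psum_normed_WFPP : (forall i, (1%:E < Mcoef (X i))%E) ->
  @WFPP R V +%R *:%R Num.norm.
Proof.
move=> XM C T C0 convC wC TC Tne0.
have Tne x y : C x -> C y -> `|T x - T y| <= `|x - y|.
  by move=> Cx Cy; have := Tne0 x y Cx Cy; rewrite /vsub !scaleN1r.
have [K iK Kmin] := minimal_closed_invariant wC convC TC C0.
have [K0 cK convK KC KT] := iK.
have wK := wcompact_closed_sub wC KC cK convK.
have KTne x y : K x -> K y -> `|T x - T y| <= `|x - y|.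
  by move=> /KC Cx /KC; exact: Tne.
(* Minimality is restated relative to [K], which replaces [C] as the ambient set. *)
have Kmin' L : closed_invariant K T L -> L = K.
  move=> [L0 cL convL LK LT]; apply: Kmin => //; split => //.
  exact: subset_trans LK KC.
pose E := [set `|p.1 - p.2| | p in K `*` K].
have [M KM] := wcompact_bounded wK.
have [x Kx] := K0.
have supE : has_sup E.
  split; first by exists `|x - x|; exists (x, x).
  exists (M + M) => _ [[y z] [/= Ky Kz] <-].
  by apply: le_trans (ler_normB _ _) _; rewrite lerD// KM.
have Ksup y z : K y -> K z -> `|y - z| <= sup E.
  by move=> Ky Kz; apply: sup_upper_bound => //; exists (y, z).
have sup0 : sup E <= 0.
  apply: (minimal_diam0 XM K0 wK convK KT KTne Kmin') => // s Ks.
  apply: sup_le_ub; first by case: supE.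
  by move=> _ [[y z] [/= Ky Kz] <-]; exact: Ks.
exists x; split; first exact: KC.
apply/eqP; rewrite -subr_eq0 -normr_le0; apply: le_trans sup0.
by apply: Ksup => //; exact: KT.
Qed.

End PsumFixedPoint.

Theorem theorem3p4 (R : realType) (r : nat)
  (X : 'I_r -> completeNormedModType R) (psi : 'rV[R]_r -> R) :
  (forall i, (1%:E < Mcoef (X i))%E) ->
  is_norm_Rr psi -> absolute_norm psi -> normalized_norm psi ->
  strictly_monotone psi ->
  psum_WFPP (fun i => X i : normedModType R) psi.
Proof.
move=> XM psiN psiA psi1 psiM.
apply: (@psum_WFPP_normed _ _ _ _ psiN psiA psiM).
exact: psum_normed_WFPP.
Qed.
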